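(* For any $\Lambda_1,\Lambda_2\in\mathbb C$ we have $$\check{\mathcal R}_{\Lambda_1,\Lambda_2}\ \Xi_{\Lambda_1,\Lambda_2}=\Xi_{\Lambda_2,\Lambda_1}\ \check{\mathrm R}_{\Lambda_1,\Lambda_2}$$ as linear maps $M_{\Lambda_1}\otimes M_{\Lambda_2}\to M_{\Lambda_2}\otimes M_{\Lambda_1}$, where $\check{\mathcal R}_{\Lambda_1,\Lambda_2}=\mathcal R_{\Lambda_2,\Lambda_1}\mathrm P$ is built from the quantum $R$-matrix and $\check{\mathrm R}_{\Lambda_1,\Lambda_2}=\mathrm R_{\Lambda_2,\Lambda_1}\mathrm P$ from the asymptotic $R$-matrix, and $\mathrm P(x\otimes y)=y\otimes x$.
   Context: Fix $\eta\in\mathbb C$ with $\operatorname{Im}\eta>0$; $q^x=e^{\pi i\eta x}$, $[x]=\frac{q^x-q^{-x}}{q-q^{-1}}$, $[k]!=[1]\cdots[k]$. $\mathcal U_q(\mathfrak{sl}_2)$ is the unital algebra generated by $\mathbf E,\mathbf F,q^{x\mathbf h}$ with $q^{x\mathbf h}q^{y\mathbf h}=q^{(x+y)\mathbf h}$, $q^{x\mathbf h}\mathbf E=q^{2x}\mathbf Eq^{x\mathbf h}$, $q^{x\mathbf h}\mathbf F=q^{-2x}\mathbf Fq^{x\mathbf h}$, $\mathbf{EF}-\mathbf{FE}=\frac{q^{\mathbf h}-q^{-\mathbf h}}{q-q^{-1}}$. $M_\Lambda$ is the Verma module with highest weight vector $v_\Lambda$ of weight $\Lambda$ and basis $v_\Lambda^{(k)}=\mathbf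 F^kv_\Lambda/[k]!$; for $\Lambda\in\mathbb Z_{\ge0}$, $L_\Lambda$ is its irreducible quotient, with basis the images of $v_\Lambda^{(0)},\dots,v_\Lambda^{(\Lambda)}$. $\Xi_{\Lambda_1,\Lambda_2}\in\operatorname{End}(M_{\Lambda_1}\otimes M_{\Lambda_2})$ is diagonal: $\Xi_{\Lambda_1,\Lambda_2}(v_{\Lambda_1}^{(m_1)}\otimes v_{\Lambda_2}^{(m_2)})=q^{m_2(\Lambda_1-m_1)}v_{\Lambda_1}^{(m_1)}\otimes v_{\Lambda_2}^{(m_2)}$. Quantum $R$-matrix: $\mathcal R_{\Lambda_1,\Lambda_2}=q^{-\Lambda_1\Lambda_2/2}\Big(\sum_{k\ge0}q^{k(k-1)/2}\frac{(q-q^{-1})^k}{[k]!}\mathbf E^k\otimes\mathbf F^k\Big)q^{\frac{\mathbf h\otimes\mathbf h}2}\Big|_{M_{\Lambda_1}\otimes M_{\Lambda_2}}$, where $q^{\mathbf h\otimes\mathbf h/2}$ multiplies a tensor of weights $(a,b)$ by $q^{ab/2}$. Dynamical $R$-matrix: the family $\mathbb R_{\Lambda_1,\Lambda_2}(\lambda)\in\operatorname{End}(M_{\Lambda_1}\otimes M_{\Lambda_2})$, meromorphic in $\lambda$, with matrix elements $\mathbb R_{\Lambda_1,\Lambda_2}(\lambda)(v^{(m_1)}\otimes v^{(m_2)})=\sum_{n_1,n_2}(\mathbb R_{\Lambda_1,\Lambda_2}(\lambda))^{m_1,m_2}_{n_1,n_2}v^{(n_1)}\otimes v^{(n_2)}$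 (it is an asymptotic limit $\tau\to i\infty$, then $z\to+\infty$, of the elliptic dynamical $R$-matrix of $E_{\tau,\eta}(\mathfrak{sl}_2)$), uniquely determined by the following properties: (i) matrix elements vanish unless $m_1+m_2=n_1+n_2$; (ii) they are rational functions of $q^{\Lambda_1},q^{\Lambda_2},q^{2\lambda}$; (iii) they vanish if $\Lambda_i\in\{n_i,n_i+1,\dots,m_i-1\}$ for $i=1$ or $2$ (so for $\Lambda_1,\Lambda_2\in\mathbb Z_{\ge0}$ the operator descends to $L_{\Lambda_1}\otimes L_{\Lambda_2}$); (iv) with $\gamma_{\Lambda',\Lambda''}:M_{\Lambda'+\Lambda''}\to M_{\Lambda'}\otimes M_{\Lambda''}$, $v^{(m)}\mapsto\sum_{m'+m''=m}v^{(m')}\otimes v^{(m'')}$, one has $\gamma_{\Lambda_1,\Lambda_2}\mathbb R_{\Lambda_1+\Lambda_2,\Lambda_3}(\lambda)=\mathbb R_{\Lambda_2,\Lambda_3}(\lambda)\mathbb R_{\Lambda_1,\Lambda_3}(\lambda-\mathbf h^{(2)})\gamma_{\Lambda_1,\Lambda_2}$ and $\gamma_{\Lambda_2,\Lambda_3}\mathbb R_{\Lambda_1,\Lambda_2+\Lambda_3}(\lambda)=\mathbb R_{\Lambda_1,\Lambda_2}(\lambda-\mathbf h^{(3)})\mathbb R_{\Lambda_1,\Lambda_3}(\lambda)\gamma_{\Lambda_2,\Lambda_3}$, where $\mathbb R_{\Lambda_i,\Lambda_j}$ acts in the tensor factors $i,j$ and $\mathbf h^{(k)}$ is replaced by the weight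 of the $k$-th tensor factor; (v) on $L_1\otimes L_1$: $v^{(0)}\otimes v^{(0)}$ and $v^{(1)}\otimes v^{(1)}$ are fixed, $v^{(0)}\otimes v^{(1)}\mapsto\frac{q^{-1}[\lambda+1]}{[\lambda]}v^{(0)}\otimes v^{(1)}+\frac{q^{\lambda-1}}{[\lambda]}v^{(1)}\otimes v^{(0)}$, $v^{(1)}\otimes v^{(0)}\mapsto-\frac{q^{-\lambda-1}}{[\lambda]}v^{(0)}\otimes v^{(1)}+\frac{q^{-1}[\lambda-1]}{[\lambda]}v^{(1)}\otimes v^{(0)}$. Asymptotic $R$-matrix: $\mathrm R_{\Lambda_1,\Lambda_2}=\lim_{\lambda\to-\infty}\mathbb R_{\Lambda_1,\Lambda_2}(\lambda)$, meaning that each matrix element of $\mathbb R_{\Lambda_1,\Lambda_2}(\lambda)$, viewed as a rational function of the independent variable $q^{2\lambda}$, is evaluated at $q^{2\lambda}=0$. *)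

(* Defs.v *)
From HB Require Import structures.
From mathcomp Require Import all_boot all_order all_algebra.
From mathcomp Require Import boolp classical_sets reals sequences exp trigo.
From mathcomp Require Import complex.
From mathcomp Require Import finmap monalg.
From mathcomp Require Import ring.
Set Implicit Arguments.
Unset Strict Implicit.
Unset Printing Implicit Defensive.
Import Order.TTheory GRing.Theory Num.Theory.
Local Open Scope ring_scope.

(* The linear map on the free module with basis K extending f : K -> V. *)
HB.lock Definition linext (A : comNzRingType) (K : choiceType) (V : lmodType A)
    (f : K -> V) (t : {malg A[K]}) : V :=
  \sum_(k <- msupp t) t@_k *: f k.

Section LinextTheory.
Variables (A : comNzRingType) (K : choiceType) (V : lmodType A) (f : K -> V).

Lemma linextEw (d : {fset K}) (t : {malg A[K]}) :
  (msupp t `<=` d)%fset -> linext f t = \sum_(k <- d) t@_k *: f k.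
Proof.
move=> le; rewrite linext.unlock (big_fset_incl _ le) // => k _.
by move/mcoeff_outdom ->; rewrite scale0r.
Qed.

Lemma linext_is_linear : linear (linext f).
Proof.
move=> a x y; pose d := (msupp x `|` msupp y)%fset.
have le : (msupp (a *: x + y) `<=` d)%fset.
  apply: fsubset_trans (msuppD_le _ _) _.
  by apply: fsetUSS => //; apply: msuppZ_le.
rewrite (linextEw le) (linextEw (fsubsetUl (msupp x) (msupp y))).
rewrite (linextEw (fsubsetUr (msupp x) (msupp y))) scaler_sumr -big_split /=.
by apply: eq_bigr => k _; rewrite mcoeffD mcoeffZ scalerDl scalerA.
Qed.

HB.instance Definition _ :=
  GRing.isLinear.Build A {malg A[K]} V _ (linext f) linext_is_linear.

Lemma linextU k : linext f << k >> = f k.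
Proof.
by rewrite linext.unlock msuppU oner_eq0 big_seq_fset1 mcoeffUU scale1r.
Qed.

End LinextTheory.

Lemma qbr_comm_aux (F : fieldType) (u w q p l m : F) : u * w = 1 ->
  (u * q - w * p) / (q - p) * ((l * w - m * u) / (q - p)) -
  (u - w) / (q - p) * ((l * w * q - m * u * p) / (q - p)) =
  (q - p)^-1 * (l * w ^+ 2 - m * u ^+ 2).
Proof.
move=> uw; have [->|d0] := eqVneq (q - p) 0.
  by rewrite invr0 !mulr0 subrr mul0r.
apply: (@mulfI _ ((q - p) ^+ 2)); first by rewrite expf_neq0.
transitivity ((q - p) * (l * w ^+ 2 - m * u ^+ 2)); last by field.
transitivity ((u * q - w * p) * (l * w - m * u) -
   (u - w) * (l * w * q - m * u * p)); first by field.
ring: uw.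
Qed.

Unset Implicit Arguments.

Section QuantumGroup.
Context {R : realType}.
Local Notation C := (R[i]).

Definition cexp (z : C) : C :=
  (expR (complex.Re z))%:C%C *
  Complex (cos (complex.Im z)) (sin (complex.Im z)).

Lemma cexpD z w : cexp (z + w) = cexp z * cexp w.
Proof.
case: z w => [a b] [c d]; rewrite /cexp /= expRD cosD sinD.
by apply/eqP; rewrite eq_complex /=; apply/andP; split; apply/eqP; ring.
Qed.

Lemma cexp0 : cexp 0 = 1.
Proof. by rewrite /cexp /= expR0 cos0 sin0 mul1r. Qed.

Variable eta : C.

Definition qpow (x : C) : C := cexp ((pi : R)%:C%C * 'i%C * eta * x).

Lemma qpowD x y : qpow (x + y) = qpow x * qpow y.
Proof. by rewrite /qpow mulrDr cexpD. Qed.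

Lemma qpow0 : qpow 0 = 1.
Proof. by rewrite /qpow mulr0 cexp0. Qed.

Definition qbr (x : C) : C := (qpow x - qpow (- x)) / (qpow 1 - qpow (- 1)).

Definition qfact (k : nat) : C := \prod_(1 <= j < k.+1) qbr j%:R.

(* A U_q(sl_2)-module: a vector space with operators E, F and K x (the action
   of q^{xh}) satisfying the defining relations. *)
Record Uq_action {V : lmodType C} (E F : V -> V) (K : C -> V -> V) : Prop := {
  Uq_KK : forall x y v, K x (K y v) = K (x + y) v;
  Uq_KE : forall x v, K x (E v) = qpow (2 * x) *: E (K x v);
  Uq_KF : forall x v, K x (F v) = qpow (- (2 * x)) *: F (K x v);
  Uq_EF : forall v, E (F v) - F (E v) =
    (qpow 1 - qpow (- 1))^-1 *: (K 1 v - K (- 1) v)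
}.

(* M_L has basis v_L^(k), written << k >> below; the carrier does not depend
   on L, only the action does.  Tensor products of Verma modules are the free
   modules on the products of these bases. *)
Definition verma (L : C) : Type := {malg C[nat]}.
HB.instance Definition _ (L : C) := GRing.Lmodule.on (verma L).
Definition verma2 (L1 L2 : C) : Type := {malg C[(nat * nat)%type]}.
HB.instance Definition _ (L1 L2 : C) := GRing.Lmodule.on (verma2 L1 L2).
Definition verma3 (L1 L2 L3 : C) : Type := {malg C[(nat * nat * nat)%type]}.
HB.instance Definition _ (L1 L2 L3 : C) := GRing.Lmodule.on (verma3 L1 L2 L3).

Definition vb (L : C) (k : nat) : verma L := << k >>.
Definition vb2 (L1 L2 : C) (m1 m2 : nat) : verma2 L1 L2 := << (m1, m2) >>.
Definition vb3 (L1 L2 L3 : C) (m1 m2 m3 : nat) : verma3 L1 L2 L3 :=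
  << (m1, m2, m3) >>.

Definition tens {L1 L2 : C} (x : verma L1) (y : verma L2) : verma2 L1 L2 :=
  linext (fun i => linext (fun j => vb2 L1 L2 i j) y) x.

Definition weight (L : C) (k : nat) : C := L - 2 * k%:R.

(* The actions of E, F and q^{xh} in the basis v^(k) = F^k v_L / [k]!; see
   [verma_Uq], [verma_E0], [verma_K0] and [verma_Fpow]. *)
Definition vermaE (L : C) : verma L -> verma L :=
  linext (fun k => if k is k'.+1 then qbr (L - k'%:R) *: vb L k' else 0).
HB.instance Definition _ (L : C) :=
  GRing.isLinear.Build C (verma L) (verma L) _
    (vermaE L) (linext_is_linear _).
Definition vermaF (L : C) : verma L -> verma L :=
  linext (fun k => qbr k.+1%:R *: vb L k.+1).
HB.instance Definition _ (L : C) :=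
  GRing.isLinear.Build C (verma L) (verma L) _
    (vermaF L) (linext_is_linear _).
Definition vermaK (L : C) (x : C) : verma L -> verma L :=
  linext (fun k => qpow (x * weight L k) *: vb L k).
HB.instance Definition _ (L : C) (x : C) :=
  GRing.isLinear.Build C (verma L) (verma L) _
    (vermaK L x) (linext_is_linear _).

Lemma vermaE_vb L k :
  vermaE L (vb L k) = if k is k'.+1 then qbr (L - k'%:R) *: vb L k' else 0.
Proof. exact: linextU. Qed.

Lemma vermaF_vb L k : vermaF L (vb L k) = qbr k.+1%:R *: vb L k.+1.
Proof. exact: linextU. Qed.

Lemma vermaK_vb L x k : vermaK L x (vb L k) = qpow (x * weight L k) *: vb L k.
Proof. exact: linextU. Qed.

Lemma vermaE_Z L a t : vermaE L (a *: t) = a *: vermaE L t.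
Proof. exact: linearZ. Qed.

Lemma vermaF_Z L a t : vermaF L (a *: t) = a *: vermaF L t.
Proof. exact: linearZ. Qed.

Lemma vermaK_Z L x a t : vermaK L x (a *: t) = a *: vermaK L x t.
Proof. exact: linearZ. Qed.

Lemma verma_ind L (f g : {linear verma L -> verma L}) :
  (forall k, f (vb L k) = g (vb L k)) -> f =1 g.
Proof.
move=> fg t; rewrite (monalgE t) !linear_sum; apply: eq_bigr => k _.
have -> : << t@_k *g k >> = t@_k *: vb L k.
  by apply/malgP => j; rewrite mcoeffZ !mcoeffU mulr_natr.
by rewrite !linearZ /= fg.
Qed.

Lemma qbr0 : qbr 0 = 0.
Proof. by rewrite /qbr oppr0 subrr mul0r. Qed.

Lemma qbr_comm L (k : nat) :
  qbr k.+1%:R * qbr (L - k%:R) - qbr k%:R * qbr (L - k%:R + 1) =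
  (qpow 1 - qpow (- 1))^-1 * (qpow (weight L k) - qpow (- weight L k)).
Proof.
pose u := qpow k%:R; pose w := qpow (- k%:R); pose q := qpow 1.
pose p := qpow (- 1); pose l := qpow L; pose m := qpow (- L).
have qp : q * p = 1 by rewrite -qpowD subrr qpow0.
have uw : u * w = 1 by rewrite -qpowD subrr qpow0.
have E1 : qpow k.+1%:R = u * q by rewrite -qpowD natr1.
have E2 : qpow (- k.+1%:R) = w * p by rewrite -qpowD -natr1 opprD.
have E3 : qpow (L - k%:R) = l * w by rewrite -qpowD.
have E4 : qpow (- (L - k%:R)) = m * u.
  by rewrite -qpowD; congr qpow; ring.
have E5 : qpow (L - k%:R + 1) = l * w * q by rewrite -!qpowD.
have E6 : qpow (- (L - k%:R + 1)) = m * u * p.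
  by rewrite -!qpowD; congr qpow; ring.
have E7 : qpow (weight L k) = l * w ^+ 2.
  by rewrite expr2 -!qpowD; congr qpow; rewrite /weight; ring.
have E8 : qpow (- weight L k) = m * u ^+ 2.
  by rewrite expr2 -!qpowD; congr qpow; rewrite /weight; ring.
rewrite /qbr E1 E2 E3 E4 E5 E6 E7 E8.
exact: qbr_comm_aux.
Qed.

Lemma verma_Uq L : Uq_action (vermaE L) (vermaF L) (vermaK L).
Proof.
have EZ := vermaE_Z L; have FZ := vermaF_Z L; have KZ := vermaK_Z L.
split.
- move=> x y; pose f : {linear _ -> _} := vermaK L x \o vermaK L y.
  apply: (verma_ind L f (vermaK L (x + y))) => k; rewrite /f [LHS]/= [RHS]/=.
  by rewrite !vermaK_vb KZ vermaK_vb scalerA -qpowD mulrDl addrC.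
- move=> x; pose f : {linear _ -> _} := vermaK L x \o vermaE L.
  pose g : {linear _ -> _} := qpow (2 * x) \*: (vermaE L \o vermaK L x).
  apply: (verma_ind L f g) => k; rewrite /f /g [LHS]/= [RHS]/=.
  rewrite vermaK_vb EZ vermaE_vb.
  have E0 : vermaK L x 0 = 0 by exact: linear0.
  case: k => [|k]; first by rewrite E0 !scaler0.
  rewrite KZ vermaK_vb !scalerA; congr (_ *: _).
  rewrite -qpowD [RHS]mulrC; congr (_ * qpow _).
  by rewrite /weight -natr1; ring.
- move=> x; pose f : {linear _ -> _} := vermaK L x \o vermaF L.
  pose g : {linear _ -> _} := qpow (- (2 * x)) \*: (vermaF L \o vermaK L x).
  apply: (verma_ind L f g) => k; rewrite /f /g [LHS]/= [RHS]/=.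
  rewrite vermaK_vb vermaF_vb KZ FZ vermaK_vb vermaF_vb.
  rewrite !scalerA; congr (_ *: _).
  rewrite -qpowD [RHS]mulrC; congr (_ * qpow _).
  by rewrite /weight -natr1; ring.
- pose f : {linear verma L -> verma L} :=
    (vermaE L \o vermaF L) \- (vermaF L \o vermaE L).
  pose g : {linear verma L -> verma L} :=
    (qpow 1 - qpow (- 1))^-1 \*: (vermaK L 1 \- vermaK L (- 1)).
  apply: (verma_ind L f g) => k.
  have -> : f (vb L k) = vermaE L (vermaF L (vb L k)) -
                         vermaF L (vermaE L (vb L k)) by [].
  have -> : g (vb L k) = (qpow 1 - qpow (- 1))^-1 *:
      (vermaK L 1 (vb L k) - vermaK L (- 1) (vb L k)) by [].
  rewrite !vermaK_vb -scalerBl scalerA mul1r mulN1r -qbr_comm.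
  rewrite vermaF_vb EZ.
  rewrite 2!vermaE_vb scalerA.
  have F0 : vermaF L 0 = 0 by exact: linear0.
  case: k => [|k]; first by rewrite F0 qbr0 mul0r !subr0.
  rewrite FZ vermaF_vb scalerA -scalerBl; congr ((_ - _) *: _).
  by rewrite mulrC; congr (_ * qbr _); rewrite -natr1; ring.
Qed.

Lemma verma_E0 L : vermaE L (vb L 0) = 0.
Proof. exact: vermaE_vb. Qed.

Lemma verma_K0 L x : vermaK L x (vb L 0) = qpow (x * L) *: vb L 0.
Proof. by rewrite vermaK_vb /weight mulr0 subr0. Qed.

Lemma qfactS k : qfact k.+1 = qfact k * qbr k.+1%:R.
Proof. by rewrite /qfact big_nat_recr. Qed.

Lemma verma_Fpow L k : iter k (vermaF L) (vb L 0) = qfact k *: vb L k.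
Proof.
elim: k => [|k IHk] /=; first by rewrite /qfact big_geq // scale1r.
rewrite qfactS IHk vermaF_Z vermaF_vb scalerA; congr (_ *: _).
Qed.

Lemma verma_Epow0 L k m : (m < k)%N -> iter k (vermaE L) (vb L m) = 0.
Proof.
have E0 : vermaE L 0 = 0 by exact: linear0.
have EZ j a t : iter j (vermaE L) (a *: t) = a *: iter j (vermaE L) t.
  by elim: j => [//|j]; rewrite !iterS => ->; rewrite vermaE_Z.
elim: k m => // k IHk [|m] ltmk; rewrite iterSr vermaE_vb.
  by elim: k {IHk ltmk} => [//|k]; rewrite iterS => ->.
by rewrite EZ IHk // scaler0.
Qed.

Definition flip (L1 L2 : C) : verma2 L1 L2 -> verma2 L2 L1 :=
  linext (fun m => vb2 L2 L1 m.2 m.1).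
HB.instance Definition _ (L1 L2 : C) :=
  GRing.isLinear.Build C (verma2 L1 L2) (verma2 L2 L1) _
    (flip L1 L2) (linext_is_linear _).

Definition Xi (L1 L2 : C) : verma2 L1 L2 -> verma2 L1 L2 :=
  linext (fun m => qpow (m.2%:R * (L1 - m.1%:R)) *: vb2 L1 L2 m.1 m.2).
HB.instance Definition _ (L1 L2 : C) :=
  GRing.isLinear.Build C (verma2 L1 L2) (verma2 L1 L2) _
    (Xi L1 L2) (linext_is_linear _).

Definition qhh (L1 L2 : C) : verma2 L1 L2 -> verma2 L1 L2 :=
  linext (fun m => qpow (weight L1 m.1 * weight L2 m.2 / 2)
                     *: vb2 L1 L2 m.1 m.2).
HB.instance Definition _ (L1 L2 : C) :=
  GRing.isLinear.Build C (verma2 L1 L2) (verma2 L1 L2) _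
    (qhh L1 L2) (linext_is_linear _).

(* The sum over all k >= 0 of the terms E^k (x) F^k; on v^(m1) (x) v^(m2) the
   terms with k > m1 vanish by [verma_Epow0]. *)
Definition quasiR (L1 L2 : C) : verma2 L1 L2 -> verma2 L1 L2 :=
  linext (fun m => \sum_(k < m.1.+1)
    (qpow (k%:R * (k%:R - 1) / 2) * (qpow 1 - qpow (- 1)) ^+ k / qfact k) *:
    tens (iter k (vermaE L1) (vb L1 m.1)) (iter k (vermaF L2) (vb L2 m.2))).
HB.instance Definition _ (L1 L2 : C) :=
  GRing.isLinear.Build C (verma2 L1 L2) (verma2 L1 L2) _
    (quasiR L1 L2) (linext_is_linear _).

Definition quantumR (L1 L2 : C) : verma2 L1 L2 -> verma2 L1 L2 :=
  qpow (- (L1 * L2) / 2) \*: (quasiR L1 L2 \o qhh L1 L2).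
HB.instance Definition _ (L1 L2 : C) :=
  GRing.isLinear.Build C (verma2 L1 L2) (verma2 L1 L2) _
    (quantumR L1 L2) (linearP _).

Definition quantumR_check (L1 L2 : C) : verma2 L1 L2 -> verma2 L2 L1 :=
  quantumR L2 L1 \o flip L1 L2.
HB.instance Definition _ (L1 L2 : C) :=
  GRing.isLinear.Build C (verma2 L1 L2) (verma2 L2 L1) _
    (quantumR_check L1 L2) (linearP _).

(* [generic P]: P holds for all lambda outside the zero set of some nonzero
   polynomial in q^(2 lambda).  A meromorphic family is represented by a total
   function of lambda, whose values at the poles are irrelevant. *)
Definition generic (P : C -> Prop) : Prop :=
  exists p : {poly C}, p != 0 /\
    forall l, p.[qpow (2 * l)] != 0 -> P l.

Definition dyn_family : Type :=
  forall L1 L2 : C, C -> {linear verma2 L1 L2 -> verma2 L1 L2}.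

(* The coefficient (T)^{m1,m2}_{n1,n2} of v^(n1) (x) v^(n2) in the image of
   v^(m1) (x) v^(m2). *)
Definition mxelt {L1 L2 : C} (T : verma2 L1 L2 -> verma2 L1 L2)
    (m1 m2 n1 n2 : nat) : C :=
  mcoeff (n1, n2) (T (vb2 L1 L2 m1 m2)).

Definition eval3 (p : {poly {poly {poly C}}}) (x y z : C) : C :=
  p.[z%:P%:P].[y%:P].[x].

(* Operators on a triple tensor product acting in two of the factors; the
   operator may depend on the basis index of the remaining factor, which is how
   the dynamical shifts lambda - h^(k) are implemented. *)
Definition act12 {L1 L2 L3 : C} (T : nat -> verma2 L1 L2 -> verma2 L1 L2) :
    verma3 L1 L2 L3 -> verma3 L1 L2 L3 :=
  linext (fun m => linext (fun n => vb3 L1 L2 L3 n.1 n.2 m.2)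
                     (T m.2 (vb2 L1 L2 m.1.1 m.1.2))).
Definition act13 {L1 L2 L3 : C} (T : nat -> verma2 L1 L3 -> verma2 L1 L3) :
    verma3 L1 L2 L3 -> verma3 L1 L2 L3 :=
  linext (fun m => linext (fun n => vb3 L1 L2 L3 n.1 m.1.2 n.2)
                     (T m.1.2 (vb2 L1 L3 m.1.1 m.2))).
Definition act23 {L1 L2 L3 : C} (T : nat -> verma2 L2 L3 -> verma2 L2 L3) :
    verma3 L1 L2 L3 -> verma3 L1 L2 L3 :=
  linext (fun m => linext (fun n => vb3 L1 L2 L3 m.1.1 n.1 n.2)
                     (T m.1.1 (vb2 L2 L3 m.1.2 m.2))).

Definition gamma (L1 L2 : C) : verma (L1 + L2) -> verma2 L1 L2 :=
  linext (fun m => \sum_(i < m.+1) vb2 L1 L2 i (m - i)%N).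

(* gamma (x) id and id (x) gamma. *)
Definition gamma12 (L1 L2 L3 : C) : verma2 (L1 + L2) L3 -> verma3 L1 L2 L3 :=
  linext (fun m => linext (fun n => vb3 L1 L2 L3 n.1 n.2 m.2)
                     (gamma L1 L2 (vb (L1 + L2) m.1))).
Definition gamma23 (L1 L2 L3 : C) : verma2 L1 (L2 + L3) -> verma3 L1 L2 L3 :=
  linext (fun m => linext (fun n => vb3 L1 L2 L3 m.1 n.1 n.2)
                     (gamma L2 L3 (vb (L2 + L3) m.2))).

(* For a, b : nat, equality of the images in L_a (x) L_b, the quotient of
   M_a (x) M_b by the span of the v^(i) (x) v^(j) with i > a or j > b. *)
Definition eq_in_irr (a b : nat) (t u : verma2 a%:R b%:R) : Prop :=
  forall i j : nat, (i <= a)%N -> (j <= b)%N ->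
    mcoeff (i, j) t = mcoeff (i, j) u.

(* In [dyn_rational] the denominator is not identically zero in lambda for any
   (L1, L2): the family is meromorphic in lambda for all weights. *)
Record dynamical_R (RR : dyn_family) : Prop := {
  dyn_weight : forall (L1 L2 : C) (m1 m2 : nat),
    generic (fun l => forall n1 n2 : nat, (m1 + m2 != n1 + n2)%N ->
      mxelt (RR L1 L2 l) m1 m2 n1 n2 = 0);
  dyn_rational : forall m1 m2 n1 n2 : nat,
    exists N D : {poly {poly {poly C}}}, forall L1 L2 : C,
      (exists l, eval3 D (qpow L1) (qpow L2) (qpow (2 * l)) != 0) /\
      (forall l, eval3 D (qpow L1) (qpow L2) (qpow (2 * l)) != 0 ->
         mxelt (RR L1 L2 l) m1 m2 n1 n2 =
         eval3 N (qpow L1) (qpow L2) (qpow (2 * l)) /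
         eval3 D (qpow L1) (qpow L2) (qpow (2 * l)));
  dyn_descend : forall (L1 L2 : C) (m1 m2 n1 n2 : nat),
    (exists2 k : nat, (n1 <= k < m1)%N & L1 = k%:R) \/
    (exists2 k : nat, (n2 <= k < m2)%N & L2 = k%:R) ->
    generic (fun l => mxelt (RR L1 L2 l) m1 m2 n1 n2 = 0);
  dyn_fusion12 : forall (L1 L2 L3 : C) (t : verma2 (L1 + L2) L3),
    generic (fun l =>
      gamma12 L1 L2 L3 (RR (L1 + L2) L3 l t) =
      act23 (fun _ => RR L2 L3 l)
        (act13 (fun m2 => RR L1 L3 (l - weight L2 m2))
          (gamma12 L1 L2 L3 t)));
  dyn_fusion23 : forall (L1 L2 L3 : C) (t : verma2 L1 (L2 + L3)),
    generic (fun l =>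
      gamma23 L1 L2 L3 (RR L1 (L2 + L3) l t) =
      act12 (fun m3 => RR L1 L2 (l - weight L3 m3))
        (act13 (fun _ => RR L1 L3 l)
          (gamma23 L1 L2 L3 t)));
  dyn_fundamental :
    let v := vb2 1%:R 1%:R in
    generic (fun l =>
      [/\ eq_in_irr 1 1 (RR _ _ l (v 0 0)%N) (v 0 0)%N,
          eq_in_irr 1 1 (RR _ _ l (v 1 1)%N) (v 1 1)%N,
          eq_in_irr 1 1 (RR _ _ l (v 0 1)%N)
            ((qpow (- 1) * qbr (l + 1) / qbr l) *: (v 0 1)%N +
             (qpow (l - 1) / qbr l) *: (v 1 0)%N)
        & eq_in_irr 1 1 (RR _ _ l (v 1 0)%N)
            (- (qpow (- l - 1) / qbr l) *: (v 0 1)%N +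
             (qpow (- 1) * qbr (l - 1) / qbr l) *: (v 1 0)%N)])
}.

(* f is a rational function of q^(2 lambda), regular at q^(2 lambda) = 0 with
   value c there. *)
Definition value_at0 (f : C -> C) (c : C) : Prop :=
  exists N D : {poly C},
    [/\ D.[0] != 0,
        generic (fun l => f l = N.[qpow (2 * l)] / D.[qpow (2 * l)])
      & c = N.[0] / D.[0]].

Definition is_asymptotic (RR : dyn_family) (L1 L2 : C)
    (T : {linear verma2 L1 L2 -> verma2 L1 L2}) : Prop :=
  forall m1 m2 n1 n2 : nat,
    value_at0 (fun l => mxelt (RR L1 L2 l) m1 m2 n1 n2) (mxelt T m1 m2 n1 n2).

(* The operator characterised by [is_asymptotic]; the value 0 when there is
   none is only a default, for which the identity
   R-check Xi = Xi R-check(asymptotic) cannot hold, Xi and R being bijective. *)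
Definition asymptoticR (RR : dyn_family) (L1 L2 : C) :
    {linear verma2 L1 L2 -> verma2 L1 L2} :=
  if pselect (exists T, is_asymptotic RR L1 L2 T) is left ex
  then projT1 (cid ex) else \0.

Definition asymptoticR_check (RR : dyn_family) (L1 L2 : C) :
    verma2 L1 L2 -> verma2 L2 L1 :=
  asymptoticR RR L2 L1 \o flip L1 L2.
HB.instance Definition _ (RR : dyn_family) (L1 L2 : C) :=
  GRing.isLinear.Build C (verma2 L1 L2) (verma2 L2 L1) _
    (asymptoticR_check RR L1 L2) (linearP _).

End QuantumGroup.

Arguments dyn_family R : clear implicits.

(* Main.v *)
Require Import Defs.
From mathcomp Require Import all_boot all_order all_algebra.
From mathcomp Require Import boolp reals sequences exp trigo complex.
From mathcomp Require Import finmap monalg.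
From mathcomp Require Import ring zify.
Import Order.TTheory GRing.Theory Num.Theory.
Local Open Scope ring_scope.

(** Put p = q^-2, r = q^2 and u = p^L1.  Conjugating the quantum R-matrix by Xi
    turns its matrix elements into the coefficients

      (u r^m)^n  binom_p(j, n)  prod_(i <= s < m) (1 - u r^s)

    of v^(i) (x) v^(j), i + j = m + n, in the image of v^(m) (x) v^(n); they do
    not depend on L2 ([quantum_asymptotic_coef]).  The theorem says that these
    numbers are the values at X = 0 of the matrix elements of the dynamical
    R-matrix, viewed as functions of X = q^(2 lambda).  Call (L1, L2) regular
    when this holds for them ([asym_regular]).

    The shifts lambda - h multiply X by a nonzero constant and hence do not
    move the point X = 0, so at X = 0 the two fusion relations lose their
    dynamical twist.  The coefficients above satisfy the resulting untwisted
    relations: one is the binomial theorem for shifted factorials combined with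
    the trinomial revision of Gaussian binomials ([asym_coef_fusion12]), the
    other is the q-Vandermonde identity ([asym_coef_fusion23]).  Therefore
    regularity at (A, D) and (B, D) implies regularity at (A + B, D), and
    similarly in the second weight ([asym_regular_fusion12],
    [asym_regular_fusion23]).

    Starting from the explicit R-matrix on L_1 (x) L_1, fusion reaches all
    pairs of positive integers, for indices inside the finite-dimensional
    quotients ([asym_regular_nat]).  A matrix element is a quotient N / D of
    polynomials in q^L1, q^L2 and X; as the points (q^a, q^b) are Zariski dense,
    comparing the lowest coefficients in X of N and D extends regularity to the
    complement of a curve in the plane of (q^L1, q^L2)
    ([asym_regular_generic]).  On that curve N / D may be of the form 0 / 0 at
    X = 0, and rationality alone gives nothing; but both weights
    can be split into sums such that all four pairs of summands avoid the curve,
    so one more use of fusion covers all (L1, L2) ([asym_regular_all]). *)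

(** * Gaussian binomials and shifted factorials *)

Section GaussBinomial.
Context {F : comNzRingType}.
Implicit Types p r u x y : F.

(** Defined by the Pascal rule, so that no division is needed and the values
    outside the range 0 <= k <= n are zero. *)
Fixpoint gbin p (n k : nat) : F :=
  match n, k with
  | _, 0 => 1
  | 0, _.+1 => 0
  | n'.+1, k'.+1 => p ^+ k'.+1 * gbin p n' k'.+1 + gbin p n' k'
  end.

Definition qfac p (n : nat) : F := \prod_(1 <= s < n.+1) (1 - p ^+ s).

Definition qpoch r u (i m : nat) : F := \prod_(i <= s < m) (1 - u * r ^+ s).

Lemma gbinn0 p n : gbin p n 0 = 1.
Proof. by case: n. Qed.

Lemma gbinS p n k :
  gbin p n.+1 k.+1 = p ^+ k.+1 * gbin p n k.+1 + gbin p n k.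
Proof. by []. Qed.

Lemma gbin_small p n k : (n < k)%N -> gbin p n k = 0.
Proof.
elim: n k => [|n IH] [|k] //= nk.
by rewrite !IH ?mulr0 ?addr0 // ltnW.
Qed.

Lemma gbinnn p n : gbin p n n = 1.
Proof. by elim: n => //= n ->; rewrite gbin_small // mulr0 add0r. Qed.

Lemma qfacS p n : qfac p n.+1 = qfac p n * (1 - p ^+ n.+1).
Proof. by rewrite /qfac big_nat_recr. Qed.

Lemma qfac0 p : qfac p 0 = 1.
Proof. by rewrite /qfac big_geq. Qed.

Lemma gbin_qfac p n k : gbin p (n + k) k * qfac p k * qfac p n = qfac p (n + k).
Proof.
elim: n k => [|n IHn] k; first by rewrite gbinnn qfac0 mul1r mulr1.
elim: k => [|k IHk]; first by rewrite addn0 gbinn0 qfac0 !mul1r.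
rewrite addnS gbinS.
rewrite -addnS mulrDl mulrDl.
rewrite (_ : _ * qfac p n.+1 = p ^+ k.+1 * (1 - p ^+ n.+1) *
  (gbin p (n + k.+1) k.+1 * qfac p k.+1 * qfac p n)); last first.
  by rewrite addSnnS (qfacS p n); ring.
rewrite IHn -addSnnS (_ : gbin p (n.+1 + k) k * qfac p k.+1 * _ =
  (1 - p ^+ k.+1) * (gbin p (n.+1 + k) k * qfac p k * qfac p n.+1)); last first.
  by rewrite (qfacS p k); ring.
rewrite IHk addSnnS !addnS !qfacS.
have -> : p ^+ (n + k).+2 = p ^+ n.+1 * p ^+ k.+1.
  by rewrite -exprD addSn addnS.
ring.
Qed.

(** The q-Vandermonde identity, by induction on a: the two terms of the Pascal
    rule for binom(a + 1, i) give the two terms of the rule for the sum. *)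
Lemma gbin_vandermonde p a b n :
  gbin p (a + b) n =
  \sum_(i < n.+1) p ^+ ((a - i) * (n - i)) * gbin p a i * gbin p b (n - i).
Proof.
elim: a n => [|a IHa] n.
  rewrite add0n big_ord_recl /= big1 ?addr0 => [|i _].
    by rewrite sub0n mul0n expr0 !mul1r subn0.
  by rewrite mulr0 mul0r.
case: n => [|n].
  by rewrite big_ord_recl big_ord0 /= !gbinn0 subnn muln0 expr0 !mul1r addr0.
rewrite addSn gbinS !IHa.
rewrite [RHS]big_ord_recl /= [in LHS]big_ord_recl /= mulrDr.
rewrite !subn0 !gbinn0 !mulr1 -addrA; congr (_ + _).
  by rewrite mulrA -exprD; congr (p ^+ _ * _); lia.
rewrite mulr_sumr -big_split /=; apply: eq_bigr => i _.
rewrite /bump /= !add1n !subSS mulrDr mulrDl; congr (_ + _).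
have [ia|ia] := leqP i.+1 a; last by rewrite gbin_small //; ring.
have -> : ((a - i) * (n - i) = (a - i.+1) * (n - i) + (n - i))%N by nia.
rewrite exprD.
have -> : p ^+ n.+1 = p ^+ (n - i) * p ^+ i.+1.
  by rewrite -exprD; congr (_ ^+ _); have := ltn_ord i; lia.
by ring.
Qed.

Lemma qpochS r u i m : (i <= m)%N ->
  qpoch r u i m.+1 = qpoch r u i m * (1 - u * r ^+ m).
Proof. by move=> im; rewrite /qpoch big_nat_recr. Qed.

Lemma qpoch_geq r u i m : (m <= i)%N -> qpoch r u i m = 1.
Proof. by move=> im; rewrite /qpoch big_geq. Qed.

Lemma qpoch_shift r u i k : qpoch r u i (i + k) = qpoch r (u * r ^+ i) 0 k.
Proof.
rewrite /qpoch addnC -[X in \prod_(X <= _ < _) _]add0n big_addn addnK.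
apply: eq_bigr => s _.
by rewrite addnC exprD mulrA.
Qed.

(** The binomial theorem (xy; r)_k = sum_i binom_r(k, i) y^i (x; r)_i (y; r)_(k-i),
    written with binom_p for p = 1/r, which costs the factor r^(i(k-i)).  The
    step from k to k + 1 splits the new factor as
    1 - x y r^k = (1 - y r^(k-i)) + y r^(k-i) (1 - x r^i),
    one half for each term of the Pascal rule. *)
Lemma qpoch_binomial p r x y k : r * p = 1 ->
  qpoch r (x * y) 0 k =
  \sum_(i < k.+1) gbin p k i * r ^+ (i * (k - i)) * y ^+ i *
     qpoch r x 0 i * qpoch r y 0 (k - i).
Proof.
move=> rp; have rpX n : r ^+ n * p ^+ n = 1 by rewrite -exprMn rp expr1n.
elim: k => [|k IHk].
  by rewrite big_ord_recl big_ord0 /= addr0 !qpoch_geq // !expr0 !mul1r.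
rewrite qpochS // IHk mulr_suml.
pose f i := gbin p k i * r ^+ (i * (k - i)) * y ^+ i * qpoch r x 0 i *
  qpoch r y 0 (k.+1 - i).
pose g i := gbin p k i * r ^+ (i * (k - i)) * r ^+ (k - i) * y ^+ i.+1 *
  qpoch r x 0 i.+1 * qpoch r y 0 (k - i).
rewrite (eq_bigr (fun i : 'I_k.+1 => f i + g i)) => [|[i /= ik] _]; last first.
  rewrite /f /g subSn // !qpochS // exprS.
  have -> : r ^+ k = r ^+ (k - i) * r ^+ i by rewrite -exprD subnK.
  by ring.
rewrite big_split /= big_ord_recl [RHS]big_ord_recl /= -addrA.
congr (_ + _); first by rewrite /f !gbinn0.
have -> : \sum_(i < k) f (bump 0 i) = \sum_(i < k.+1) f i.+1.
  by rewrite big_ord_recr /= [f k.+1]/f gbin_small // !mul0r addr0.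
rewrite -big_split /=; apply: eq_bigr => -[i /= ik] _.
rewrite /f /g /bump /= add1n !subSS -!mulrDl; congr (_ * _ * _).
congr (_ * _); rewrite add0n.
have [ik'|ik'] := leqP i.+1 k; last first.
  rewrite gbin_small //; have -> : i = k by lia.
  by rewrite subnn !muln0 !expr0; ring.
have E : r ^+ (i.+1 * (k - i)) = r ^+ (i * (k - i)) * r ^+ (k - i).
  by rewrite -exprD; congr (_ ^+ _); lia.
have E' : p ^+ i.+1 * r ^+ (i.+1 * (k - i)) = r ^+ (i.+1 * (k - i.+1)).
  have -> : (i.+1 * (k - i) = i.+1 + i.+1 * (k - i.+1))%N by nia.
  by rewrite exprD mulrA [p ^+ _ * _]mulrC rpX mul1r.
by rewrite -E' -mulrA -E; ring.
Qed.

End GaussBinomial.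

(** * The coefficients of the asymptotic R-matrix *)

Section AsymptoticCoefficients.
Context {F : fieldType}.
Context (p r : F) (rp : r * p = 1) (pX : forall n, qfac p n != 0).

(** The candidate for the matrix element (m, n) -> (i, j), for u = q^(-2 L1).
    The binomial binom(j, n) is preferred to the equal binom(j, m - i), since it
    vanishes by itself when i > m. *)
Definition asym_coef (u : F) (m n i j : nat) : F :=
  if (m + n == i + j)%N then (u * r ^+ m) ^+ n * gbin p j n * qpoch r u i m
  else 0.

Lemma asym_coef_weight u m n i j : (m + n != i + j)%N -> asym_coef u m n i j = 0.
Proof. by rewrite /asym_coef => /negbTE ->. Qed.

(** For u = p^a, that is L1 = a, the factor with s = a kills the passage from
    the maximal submodule of M_a to its complement. *)
Lemma asym_coef_descend1 a m n i j : (i <= a < m)%N ->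
  asym_coef (p ^+ a) m n i j = 0.
Proof.
move=> /andP[ia am]; rewrite /asym_coef; case: ifP => // _.
rewrite /qpoch (@big_cat_nat _ _ _ a) ?(ltnW am) //=.
rewrite [X in _ * (_ * X)]big_ltn // -exprMn [p * r]mulrC rp expr1n.
by rewrite subrr mul0r !mulr0.
Qed.

Lemma asym_coef_small u m n i j : (j < n)%N -> asym_coef u m n i j = 0.
Proof.
by move=> jn; rewrite /asym_coef gbin_small // mulr0 mul0r if_same.
Qed.

Lemma asym_coef_up u m n i j : (m < i)%N -> asym_coef u m n i j = 0.
Proof.
move=> mi; have [E|/asym_coef_weight//] := eqVneq (m + n)%N (i + j)%N.
by apply: asym_coef_small; lia.
Qed.

Lemma gbin_trinomial n a b :
  gbin p (n + a) n * gbin p (n + a + b) (n + a) =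
  gbin p (n + a + b) n * gbin p (a + b) a.
Proof.
have E1 := gbin_qfac p a n; have E2 := gbin_qfac p b (n + a).
have E3 := gbin_qfac p (a + b) n; have E4 := gbin_qfac p b a.
rewrite addnC in E1; rewrite addnC in E2; rewrite addnC addnA in E3.
rewrite addnC in E4.
apply: (mulIf (pX n)); apply: (mulIf (pX a)); apply: (mulIf (pX b)).
transitivity (qfac p (n + a + b)); first by rewrite -E2 -E1; ring.
by rewrite -E3 -E4; ring.
Qed.

Lemma sum_window (f : nat -> F) a k m : (a + k <= m)%N ->
  (forall s, (s < a)%N -> f s = 0) -> (forall s, (a + k < s)%N -> f s = 0) ->
  \sum_(s < m.+1) f s = \sum_(s < k.+1) f (a + s)%N.
Proof.
move=> akm f0 f1; rewrite -(big_mkord xpredT f).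
rewrite (@big_cat_nat _ _ _ a) //=; last by lia.
rewrite big_nat big1 ?add0r => [|s /andP[_ sa]]; last exact: f0.
rewrite (@big_cat_nat _ _ _ (a + k).+1) //=; try lia.
rewrite [X in _ + X]big_nat [X in _ + X]big1 ?addr0 => [|s /andP[sa _]];
  last exact: f1.
rewrite -[X in \sum_(X <= _ < _) _]add0n big_addn -addnS addKn big_mkord.
by apply: eq_bigr => i _; rewrite addnC.
Qed.

(** Fusion in the first factor.  The terms vanish unless s = i1 + s' with
    0 <= s' <= k = m - i1 - i2; then trinomial revision separates the binomials
    and [qpoch_binomial] with x = u1 r^i1, y = u2 r^i2 sums the rest. *)
Lemma asym_coef_fusion12 u1 u2 m n i1 i2 j : (i1 + i2 + j = m + n)%N ->
  asym_coef (u1 * u2) m n (i1 + i2) j =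
  \sum_(s < m.+1) asym_coef u1 s n i1 (s + n - i1) *
                  asym_coef u2 (m - s) (s + n - i1) i2 j.
Proof.
move=> E; have [mi|im] := ltnP m (i1 + i2).
  rewrite asym_coef_small; last by lia.
  rewrite big1 // => -[s /= sm] _.
  have [si|is1] := ltnP s i1; first by rewrite asym_coef_up ?mul0r.
  by rewrite [X in _ * X]asym_coef_up ?mulr0 //; lia.
have [k Em] : exists k, (m = i1 + i2 + k)%N by exists (m - (i1 + i2))%N; lia.
have Ej : (j = n + k)%N by lia.
pose f s := asym_coef u1 s n i1 (s + n - i1) * asym_coef u2 (m - s) (s + n - i1) i2 j.
rewrite (sum_window f i1 k); first last.
- by move=> s si; rewrite /f [X in _ * X]asym_coef_small ?mulr0 //; lia.
- by move=> s si; rewrite /f asym_coef_up ?mul0r.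
- by lia.
rewrite /f {f}.
subst m j.
rewrite /asym_coef (_ : (_ == _) = true); last by apply/eqP; lia.
rewrite qpoch_shift.
have -> : u1 * u2 * r ^+ (i1 + i2) = (u1 * r ^+ i1) * (u2 * r ^+ i2).
  by rewrite exprD; ring.
rewrite (@qpoch_binomial _ p) // mulr_sumr; apply: eq_bigr => -[s /= sk] _.
have [t Ek] : exists t, (k = s + t)%N by exists (k - s)%N; lia.
subst k.
rewrite !ifT; try (apply/eqP; lia).
have -> : (i1 + s + n - i1 = n + s)%N by lia.
have -> : (i1 + i2 + (s + t) - (i1 + s) = i2 + t)%N by lia.
have -> : (s + t - s = t)%N by lia.
rewrite (qpoch_shift r u1) (qpoch_shift r u2) !addnA.
rewrite [RHS](_ : _ = (u1 * r ^+ (i1 + s)) ^+ n * (u2 * r ^+ (i2 + t)) ^+ (n + s)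
  * qpoch r (u1 * r ^+ i1) 0 s * qpoch r (u2 * r ^+ i2) 0 t *
  (gbin p (n + s) n * gbin p (n + s + t) (n + s))); last by ring.
rewrite gbin_trinomial.
have -> : (u2 * r ^+ (i2 + t)) ^+ (n + s) = (u2 * r ^+ (i2 + t)) ^+ n *
  (u2 * r ^+ i2) ^+ s * r ^+ (s * t).
  rewrite exprD exprMn (exprMn s) (exprMn s) -!exprM !mulnDl !exprD.
  by rewrite [(t * s)%N]mulnC; ring.
have -> : (u1 * u2 * r ^+ (i1 + i2 + s + t)) ^+ n =
  (u1 * r ^+ (i1 + s)) ^+ n * (u2 * r ^+ (i2 + t)) ^+ n.
  by rewrite -exprMn; congr (_ ^+ _); rewrite !exprD; ring.
ring.
Qed.

(** Fusion in the second factor: the shifted factorials of the two successive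
    operators concatenate, and what is left is [gbin_vandermonde]. *)
Lemma asym_coef_fusion23 u m n i j1 j2 : (i + j1 + j2 = m + n)%N ->
  asym_coef u m n i (j1 + j2) =
  \sum_(s < n.+1) asym_coef u m s (m + s - j2) j2 *
                  asym_coef u (m + s - j2) (n - s) i j1.
Proof.
move=> E; have [jn|nj] := ltnP (j1 + j2) n.
  rewrite asym_coef_small // big1 // => -[s /= sn] _.
  have [sj|js] := ltnP j2 s; first by rewrite asym_coef_small ?mul0r //; lia.
  by rewrite [X in _ * X]asym_coef_small ?mulr0 //; lia.
rewrite {1}/asym_coef ifT; last by apply/eqP; lia.
rewrite addnC gbin_vandermonde mulrC mulr_sumr; rewrite mulr_sumr.
apply: eq_bigr => -[s /= sn] _.
have [sj|js] := ltnP j2 s.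
  by rewrite asym_coef_small // gbin_small // !(mulr0, mul0r).
have [jn1|js'] := ltnP j1 (n - s).
  rewrite [asym_coef u (m + s - j2) _ _ _]asym_coef_small //.
  by rewrite [gbin p j1 _]gbin_small // !mulr0.
rewrite /asym_coef !ifT; try (apply/eqP; lia).
have [t Ej] : exists t, (j2 = s + t)%N by exists (j2 - s)%N; lia.
have [t' En] : exists t, (n = s + t)%N by exists (n - s)%N; lia.
have [t'' Em] : exists t'', (m = t + t'')%N by exists (m - t)%N; lia.
subst j2 n m; rewrite !addKn.
have -> : (t + t'' + s - (s + t) = t'')%N by lia.
have -> : qpoch r u i (t + t'') = qpoch r u i t'' * qpoch r u t'' (t + t'').
  by rewrite /qpoch -big_cat_nat //=; lia.
have E1 : (u * r ^+ (t + t'')) ^+ (s + t') * p ^+ (t * t') =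
  (u * r ^+ (t + t'')) ^+ s * (u * r ^+ t'') ^+ t'.
  rewrite [(u * _) ^+ (s + t')]exprD -mulrA; congr (_ * _).
  rewrite exprM -exprMn; congr (_ ^+ _).
  by rewrite exprD -[RHS]mulr1 -(expr1n _ t) -rp exprMn; ring.
rewrite [LHS](_ : _ = qpoch r u i t'' * qpoch r u t'' (t + t'') *
  ((u * r ^+ (t + t'')) ^+ (s + t') * p ^+ (t * t')) *
  gbin p (s + t) s * gbin p j1 t'); last by ring.
rewrite E1.
ring.
Qed.

End AsymptoticCoefficients.

(** * Powers of q *)

Section QPowers.
Context {R : realType}.
Local Notation C := R[i].
Context (eta : C).
Local Notation q := (qpow eta).

Lemma qpowVr x : q x * q (- x) = 1.
Proof. by rewrite -qpowD subrr qpow0. Qed.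

Lemma qpow_neq0 x : q x != 0.
Proof.
by apply/eqP => E; have := qpowVr x; rewrite E mul0r => /esym/eqP; rewrite oner_eq0.
Qed.

Lemma qpowN x : q (- x) = (q x)^-1.
Proof. by apply: (mulfI (qpow_neq0 x)); rewrite qpowVr divff ?qpow_neq0. Qed.

Lemma qpowB x y : q (x - y) = q x / q y.
Proof. by rewrite qpowD qpowN. Qed.

Lemma qpowMn x k : q (x * k%:R) = q x ^+ k.
Proof.
elim: k => [|k IHk]; first by rewrite mulr0 qpow0.
by rewrite -natr1 mulrDr mulr1 qpowD IHk exprSr.
Qed.

Lemma qpow_nat k : q k%:R = q 1 ^+ k.
Proof. by rewrite -qpowMn mul1r. Qed.

Lemma cexp_norm (z : C) : `|cexp z| = (expR (complex.Re z))%:C%C.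
Proof.
rewrite /cexp normrM [X in _ * X]normc_def /= cos2Dsin2 sqrtr1 mulr1.
by rewrite ger0_norm // lecR expR_ge0.
Qed.

Context (Heta : 0 < complex.Im eta).

Lemma qpow1_norm : `|q 1| < 1.
Proof.
rewrite /qpow cexp_norm mulr1.
have -> : complex.Re ((pi : R)%:C%C * 'i%C * eta) = - (pi * complex.Im eta).
  by case: eta => a b /=; ring.
by rewrite (_ : 1 = (1 : R)%:C%C) // ltcR expR_lt1 oppr_lt0 mulr_gt0 ?pi_gt0.
Qed.

(** Since |q| < 1, no power of q repeats. *)
Lemma qpow_nat_inj c : injective (fun k => q 1 ^+ (c.+1 * k)%N).
Proof.
move=> k j /(congr1 Num.norm); rewrite !normrX => E.
have n0 : 0 < `|q 1| by rewrite normr_gt0 qpow_neq0.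
have /eqP : (c.+1 * k = c.+1 * j)%N.
  by apply: (ieexprIn n0) => //; rewrite lt_eqF ?qpow1_norm.
by rewrite eqn_mul2l /= => /eqP.
Qed.

End QPowers.

(** * Values at X = 0 of functions of X = q^(2 lambda) *)

Section PolynomialValues.
Context {A : idomainType}.

Lemma horner_eventually_neq0 (p : {poly A}) (f : nat -> A) :
  injective f -> p != 0 ->
  exists K : nat, forall k : nat, (K <= k)%N -> p.[f k] != 0.
Proof.
move=> finj; have [n] := ubnP (size p); elim: n p => // n IHn p pn p0.
have [[k0 pk0]|nopk] := pselect (exists k, root p (f k)); last first.
  by exists 0%N => k _; apply/negP => pk; apply: nopk; exists k.
have /factor_theorem [p1 Ep] := pk0.
have p10 : p1 != 0 by apply: contraNneq p0 => p10; rewrite Ep p10 mul0r.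
case: (IHn p1) => [| |K HK] //.
  by move: pn; rewrite Ep size_Mmonic ?monicXsubC // size_XsubC addn2.
exists (maxn K k0.+1) => k; rewrite geq_max => /andP[Kk k0k].
rewrite Ep hornerM hornerXsubC mulf_neq0 ?HK // subr_eq0.
by apply: contraTneq k0k => /finj ->; rewrite ltnn.
Qed.

Lemma poly_eq0_infinite (p : {poly A}) (f : nat -> A) K :
  injective f -> (forall k : nat, (K <= k)%N -> p.[f k] = 0) -> p = 0.
Proof.
move=> finj pf; apply/eqP/negP => /negP p0.
have [K' HK'] := horner_eventually_neq0 p f finj p0.
by have := HK' (maxn K K') (leq_maxr _ _); rewrite pf ?leq_maxl // eqxx.
Qed.

End PolynomialValues.

Section GenericValues.
Context {R : realType}.
Local Notation C := R[i].
Context (eta : C).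
Local Notation q := (qpow eta).
Implicit Types (P Q : C -> Prop) (f g : C -> C).

Lemma generic_mono P Q : (forall l, P l -> Q l) -> generic eta P -> generic eta Q.
Proof. by move=> PQ [p [p0 Pp]]; exists p; split=> // l /Pp /PQ. Qed.

Lemma genericT P : (forall l, P l) -> generic eta P.
Proof. by move=> PT; exists 1; split; rewrite ?oner_eq0. Qed.

Lemma generic_and P Q :
  generic eta P -> generic eta Q -> generic eta (fun l => P l /\ Q l).
Proof.
move=> [p [p0 Pp]] [p' [p'0 Qp]]; exists (p * p'); split.
  by rewrite mulf_neq0.
by move=> l; rewrite hornerM mulf_eq0 negb_or => /andP[/Pp ? /Qp ?].
Qed.

Lemma generic_forall (T : finType) (P : T -> C -> Prop) :
  (forall x, generic eta (P x)) -> generic eta (fun l => forall x, P x l).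
Proof.
move=> /(@fin_all_exists T (fun=> {poly C})) [p Hp].
exists (\prod_x p x); split.
  by apply/prodf_neq0 => x _; case: (Hp x).
move=> l; rewrite horner_prod => /prodf_neq0 pl x.
by case: (Hp x) => _; apply; apply: pl.
Qed.

(** A shift of lambda rescales q^(2 lambda) by a nonzero constant. *)
Lemma generic_shift P w : generic eta P -> generic eta (fun l => P (l - w)).
Proof.
move=> [p [p0 Pp]]; pose c := q (- (2 * w)).
have c0 : c != 0 by apply: qpow_neq0.
exists (p \Po (c *: 'X)); split.
  by rewrite comp_poly2_eq0 // size_scale // size_polyX.
move=> l; rewrite horner_comp hornerZ hornerX => pl; apply: Pp.
by rewrite mulrBr qpowD mulrC.
Qed.

Lemma generic_neq0 (p : {poly C}) :
  p != 0 -> generic eta (fun l => p.[q (2 * l)] != 0).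
Proof. by move=> p0; exists p; split. Qed.

Lemma value_at0_ext f g c : generic eta (fun l => f l = g l) ->
  value_at0 eta f c -> value_at0 eta g c.
Proof.
move=> fg [N [D [D0 fND ->]]]; exists N, D; split=> //.
by apply: generic_mono (generic_and _ _ fg fND) => l [<-].
Qed.

Lemma value_at0_eq f g c : (forall l, f l = g l) ->
  value_at0 eta f c -> value_at0 eta g c.
Proof. by move=> fg; apply/value_at0_ext/genericT. Qed.

Lemma value_at0_frac (N D : {poly C}) : D.[0] != 0 ->
  value_at0 eta (fun l => N.[q (2 * l)] / D.[q (2 * l)]) (N.[0] / D.[0]).
Proof. by move=> D0; exists N, D; split=> //; apply: genericT. Qed.

Lemma value_at0_const c : value_at0 eta (fun=> c) c.
Proof.
exists c%:P, 1; rewrite !hornerC divr1 oner_eq0; split=> //.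
by apply: genericT => l; rewrite !hornerC divr1.
Qed.

Lemma horner0_neq0 (D : {poly C}) : D.[0] != 0 -> D != 0.
Proof. by apply: contraNneq => ->; rewrite horner0. Qed.

Lemma value_at0_add f g c d : value_at0 eta f c -> value_at0 eta g d ->
  value_at0 eta (fun l => f l + g l) (c + d).
Proof.
move=> [N [D [D0 fND ->]]] [N' [D' [D'0 gND ->]]].
exists (N * D' + N' * D), (D * D'); split; first by rewrite hornerM mulf_neq0.
  have GD := generic_neq0 _ (horner0_neq0 _ D0).
  have GD' := generic_neq0 _ (horner0_neq0 _ D'0).
  move: (generic_and _ _ (generic_and _ _ fND gND) (generic_and _ _ GD GD')).
  apply: generic_mono => l [[-> ->] [Dl D'l]].
  by rewrite !hornerE addf_div.
by rewrite !hornerE addf_div.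
Qed.

Lemma value_at0_mul f g c d : value_at0 eta f c -> value_at0 eta g d ->
  value_at0 eta (fun l => f l * g l) (c * d).
Proof.
move=> [N [D [D0 fND ->]]] [N' [D' [D'0 gND ->]]].
exists (N * N'), (D * D'); split; first by rewrite hornerM mulf_neq0.
  move: (generic_and _ _ fND gND).
  by apply: generic_mono => l [-> ->]; rewrite !hornerM mulf_div.
by rewrite !hornerM mulf_div.
Qed.

Lemma value_at0_sum n (f : 'I_n -> C -> C) (c : 'I_n -> C) :
  (forall i, value_at0 eta (f i) (c i)) ->
  value_at0 eta (fun l => \sum_i f i l) (\sum_i c i).
Proof.
elim: n f c => [|n IHn] f c fc.
  rewrite big_ord0; apply: value_at0_eq (value_at0_const 0) => l.
  by rewrite big_ord0.
rewrite big_ord_recl.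
have IH := IHn (fun i => f (lift ord0 i)) (fun i => c (lift ord0 i)).
apply: value_at0_eq (value_at0_add _ _ _ _ (fc ord0) (IH (fun i => fc _))).
by move=> l; rewrite big_ord_recl.
Qed.

(** The shift rescales q^(2 lambda), which fixes the point 0: this is why the
    dynamical shifts disappear from the fusion relations in the limit. *)
Lemma value_at0_shift f c w : value_at0 eta f c ->
  value_at0 eta (fun l => f (l - w)) c.
Proof.
move=> [N [D [D0 fND ->]]]; pose a := q (- (2 * w)).
exists (N \Po (a *: 'X)), (D \Po (a *: 'X)).
rewrite !horner_comp !hornerZ !hornerX !mulr0; split=> //.
apply: generic_mono (generic_shift _ w fND) => l ->.
by rewrite !horner_comp !hornerZ !hornerX /a -qpowD mulrBr addrC.
Qed.

Context (Heta : 0 < complex.Im eta).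

Lemma generic_poly_eq (p p' : {poly C}) :
  generic eta (fun l => p.[q (2 * l)] = p'.[q (2 * l)]) -> p = p'.
Proof.
move=> [d [d0 Hd]]; apply/eqP; rewrite -subr_eq0; apply/eqP.
pose f k := q 1 ^+ (2 * k)%N.
have fE k : f k = q (2 * k%:R) by rewrite /f -natrM qpow_nat.
have finj : injective f := qpow_nat_inj eta Heta 1.
have : (p - p') * d = 0.
  apply: (poly_eq0_infinite _ f 0) => // k _; rewrite hornerM fE.
  have [->|/Hd dk] := eqVneq d.[q (2 * k%:R)] 0; first by rewrite mulr0.
  by rewrite hornerD hornerN dk subrr mul0r.
by move=> /eqP; rewrite mulf_eq0 (negbTE d0) orbF => /eqP.
Qed.

Lemma value_at0_unique f c d :
  value_at0 eta f c -> value_at0 eta f d -> c = d.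
Proof.
move=> [N [D [D0 fND ->]]] [N' [D' [D'0 gND ->]]].
have E : N * D' = N' * D.
  apply: generic_poly_eq.
  have GD := generic_neq0 _ (horner0_neq0 _ D0).
  have GD' := generic_neq0 _ (horner0_neq0 _ D'0).
  move: (generic_and _ _ (generic_and _ _ fND gND) (generic_and _ _ GD GD')).
  apply: generic_mono => l [[-> ] E [Dl D'l]].
  by rewrite !hornerM; apply/eqP; rewrite -eqr_div ?E.
by apply/eqP; rewrite eqr_div // -!hornerM E.
Qed.

End GenericValues.

(** * Matrix elements of the fusion relations *)

Section LinextCoefficients.
Context {A : comNzRingType} {K K' : choiceType}.
Implicit Types (f : K -> {malg A[K']}) (t : {malg A[K]}).

Lemma mcoeff_linext f t k :
  (linext f t)@_k = \sum_(x <- msupp t) t@_x * (f x)@_k.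
Proof.
rewrite linext.unlock raddf_sum; apply: eq_bigr => x _.
by rewrite /= mcoeffZ.
Qed.

Lemma mcoeff_linext_pick f t k k0 : (forall x, (f x)@_k = (x == k0)%:R) ->
  (linext f t)@_k = t@_k0.
Proof.
move=> fk; rewrite mcoeff_linext.
rewrite (eq_bigr (fun x => t@_x * (x == k0)%:R)) => [|x _]; last by rewrite fk.
have [k0t|k0t] := boolP (k0 \in msupp t); last first.
  rewrite (mcoeff_outdom k0t) big_seq big1 // => x xt.
  case: eqVneq => [xk|_]; last by rewrite mulr0.
  by rewrite -xk xt in k0t.
rewrite (bigD1_seq k0) ?fset_uniq //= eqxx mulr1 big1 ?addr0 // => x /negbTE ->.
by rewrite mulr0.
Qed.

Lemma mcoeff_linext0 f t k : (forall x, (f x)@_k = 0) -> (linext f t)@_k = 0.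
Proof.
by move=> fk; rewrite mcoeff_linext big1 // => x _; rewrite fk mulr0.
Qed.

End LinextCoefficients.

Section Fusion.
Context {R : realType}.
Local Notation C := R[i].
Implicit Types (A B D : C).

Lemma linext_vb {V : lmodType C} (f : nat -> V) A m : linext f (vb A m) = f m.
Proof. exact: linextU. Qed.

Lemma linext_vb2 {V : lmodType C} (f : nat * nat -> V) A B m n :
  linext f (vb2 A B m n) = f (m, n).
Proof. exact: linextU. Qed.

Lemma linext_vb3 {V : lmodType C} (f : nat * nat * nat -> V) A B D m n k :
  linext f (vb3 A B D m n k) = f (m, n, k).
Proof. exact: linextU. Qed.

Lemma mcoeff_vb2 A B m n i j : (vb2 A B m n)@_(i, j) = ((m == i) && (n == j))%:R.
Proof. by rewrite mcoeffU -pair_eqE. Qed.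

Lemma mcoeff_vb3 A B D m n k i j h :
  (vb3 A B D m n k)@_(i, j, h) = [&& m == i, n == j & k == h]%:R.
Proof. by rewrite mcoeffU -!pair_eqE /= -!pair_eqE /= -andbA. Qed.

(** Weight conservation makes the support of T v explicit and finite,
    independently of T; this is what allows fusion to be evaluated for a generic
    lambda. *)
Lemma mxelt_expand A B (T : verma2 A B -> verma2 A B) m n :
  (forall i j, (m + n != i + j)%N -> mxelt T m n i j = 0) ->
  T (vb2 A B m n) =
  \sum_(i < (m + n).+1) mxelt T m n i (m + n - i) *: vb2 A B i (m + n - i).
Proof.
move=> Tw; apply/malgP => -[a b]; rewrite raddf_sum /=.
rewrite (eq_bigr (fun i : 'I_(m + n).+1 => mxelt T m n i (m + n - i) *
   ((nat_of_ord i == a) && (m + n - i == b)%N)%:R)); last first.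
  by move=> i _; rewrite mcoeffZ mcoeff_vb2.
have [E|nE] := eqVneq (m + n)%N (a + b)%N; last first.
  rewrite -[LHS]/(mxelt T m n a b) (Tw _ _ nE) big1 // => -[i /= imn] _.
  by rewrite (_ : _ && _ = false) ?mulr0 //; apply/negbTE; move: nE imn; lia.
have amn : (a < (m + n).+1)%N by lia.
rewrite (bigD1 (Ordinal amn)) //= eqxx /= big1 ?addr0 => [|i]; last first.
  by rewrite -val_eqE /= => /negbTE ->; rewrite mulr0.
by rewrite (_ : (m + n - a = b)%N) ?eqxx ?mulr1; last by lia.
Qed.

Lemma gamma12_vb A B D m n : gamma12 A B D (vb2 (A + B) D m n) =
  \sum_(s < m.+1) vb3 A B D s (m - s) n.
Proof.
rewrite /gamma12 linext_vb2 /= /gamma linext_vb linear_sum.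
by apply: eq_bigr => s _; rewrite /= linext_vb2.
Qed.

Lemma gamma23_vb A B D m n : gamma23 A B D (vb2 A (B + D) m n) =
  \sum_(s < n.+1) vb3 A B D m s (n - s).
Proof.
rewrite /gamma23 linext_vb2 /= /gamma linext_vb linear_sum.
by apply: eq_bigr => s _; rewrite /= linext_vb2.
Qed.

Lemma gamma12_coef A B D (t : verma2 (A + B) D) i1 i2 j :
  (gamma12 A B D t)@_(i1, i2, j) = t@_((i1 + i2)%N, j).
Proof.
apply: mcoeff_linext_pick => -[m n] /=; rewrite /gamma linext_vb linear_sum.
rewrite raddf_sum /= (eq_bigr (fun s : 'I_m.+1 =>
  [&& nat_of_ord s == i1, (m - s == i2)%N & n == j]%:R)) => [|s _]; last first.
  by rewrite /= linext_vb2 mcoeff_vb3.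
rewrite -pair_eqE /=; have [->|nm] := eqVneq m (i1 + i2)%N; last first.
  rewrite big1 // => -[s /= sm] _.
  by rewrite (_ : [&& _, _ & _] = false) //; apply/negbTE; move: nm sm; lia.
have i1m : (i1 < (i1 + i2).+1)%N by lia.
rewrite (bigD1 (Ordinal i1m)) //= eqxx /= addKn eqxx big1 ?addr0 => [|i]//.
by rewrite -val_eqE /= => /negbTE ->.
Qed.

Lemma gamma23_coef A B D (t : verma2 A (B + D)) i j1 j2 :
  (gamma23 A B D t)@_(i, j1, j2) = t@_(i, (j1 + j2)%N).
Proof.
apply: mcoeff_linext_pick => -[m n] /=; rewrite /gamma linext_vb linear_sum.
rewrite raddf_sum /= (eq_bigr (fun s : 'I_n.+1 =>
  [&& m == i, nat_of_ord s == j1 & (n - s == j2)%N]%:R)) => [|s _]; last first.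
  by rewrite /= linext_vb2 mcoeff_vb3.
rewrite -pair_eqE /=; have [->|nm] := eqVneq n (j1 + j2)%N; last first.
  rewrite andbF big1 // => -[s /= sm] _.
  by rewrite (_ : [&& _, _ & _] = false) //; apply/negbTE; move: nm sm; lia.
have i1m : (j1 < (j1 + j2).+1)%N by lia.
rewrite (bigD1 (Ordinal i1m)) //= eqxx /= addKn eqxx big1 ?addr0 => [|s]//.
by rewrite -val_eqE /= => /negbTE ->; rewrite andbF.
Qed.

Lemma act23_coef A B D (T : nat -> verma2 B D -> verma2 B D) s m n i j h :
  (act23 T (vb3 A B D s m n))@_(i, j, h) = (s == i)%:R * mxelt (T s) m n j h.
Proof.
rewrite /act23 linext_vb3 /=; case: eqVneq => [->|si]; last first.
  by rewrite mul0r mcoeff_linext0 // => x; rewrite mcoeff_vb3 (negbTE si).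
rewrite mul1r; apply: mcoeff_linext_pick => -[a b].
by rewrite mcoeff_vb3 eqxx.
Qed.

Lemma act12_coef A B D (T : nat -> verma2 A B -> verma2 A B) s m n i j h :
  (act12 T (vb3 A B D m n s))@_(i, j, h) = (s == h)%:R * mxelt (T s) m n i j.
Proof.
rewrite /act12 linext_vb3 /=; case: eqVneq => [->|si]; last first.
  by rewrite mul0r mcoeff_linext0 // => x; rewrite mcoeff_vb3 (negbTE si) !andbF.
rewrite mul1r; apply: mcoeff_linext_pick => -[a b].
by rewrite mcoeff_vb3 eqxx andbT.
Qed.

Lemma act13_vb A B D (T : nat -> verma2 A D -> verma2 A D) m s n :
  (forall i j, (m + n != i + j)%N -> mxelt (T s) m n i j = 0) ->
  act13 T (vb3 A B D m s n) = \sum_(i < (m + n).+1)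
    mxelt (T s) m n i (m + n - i) *: vb3 A B D i s (m + n - i).
Proof.
move=> Tw; rewrite /act13 linext_vb3 /= (mxelt_expand _ _ _ _ _ Tw) linear_sum.
by apply: eq_bigr => i _; rewrite linearZ /= linext_vb2.
Qed.

Lemma sum_ord_pick (f : nat -> C) a n : ((n < a)%N -> f a = 0) ->
  \sum_(i < n.+1) f i * (nat_of_ord i == a)%:R = f a.
Proof.
move=> f0; have [an|na] := ltnP a n.+1.
  rewrite (bigD1 (Ordinal an)) //= eqxx mulr1 big1 ?addr0 // => i.
  by rewrite -val_eqE /= => /negbTE ->; rewrite mulr0.
rewrite f0 // big1 // => i _; case: eqVneq => [E|_]; last by rewrite mulr0.
by have := ltn_ord i; rewrite E; lia.
Qed.

(** In both compositions weight conservation leaves a single intermediate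
    vector. *)
Lemma act23_act13_coef A B D (S : nat -> verma2 B D -> verma2 B D)
    (T : nat -> verma2 A D -> verma2 A D) m s n i1 i2 j :
  (forall i j, (m + n != i + j)%N -> mxelt (T s) m n i j = 0) ->
  (act23 S (act13 T (vb3 A B D m s n)))@_(i1, i2, j) =
  mxelt (T s) m n i1 (m + n - i1) * mxelt (S i1) s (m + n - i1) i2 j.
Proof.
move=> Tw; rewrite act13_vb // /act23 linear_sum raddf_sum /=.
pose f i := mxelt (T s) m n i (m + n - i) * mxelt (S i) s (m + n - i) i2 j.
rewrite -[RHS]/(f i1) -(sum_ord_pick f i1 (m + n)) => [|mn]; last first.
  by rewrite /f Tw ?mul0r //; apply/eqP; lia.
apply: eq_bigr => i _; rewrite linearZ /= mcoeffZ -[linext _ _]/(act23 S _).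
by rewrite act23_coef /f; ring.
Qed.

Lemma act12_act13_coef A B D (S : nat -> verma2 A B -> verma2 A B)
    (T : nat -> verma2 A D -> verma2 A D) m s n i j1 j2 :
  (forall i j, (m + n != i + j)%N -> mxelt (T s) m n i j = 0) ->
  (act12 S (act13 T (vb3 A B D m s n)))@_(i, j1, j2) =
  mxelt (T s) m n (m + n - j2) j2 * mxelt (S j2) (m + n - j2) s i j1.
Proof.
move=> Tw; rewrite act13_vb // /act12 linear_sum raddf_sum /=.
pose f i' := mxelt (T s) m n i' (m + n - i') * mxelt (S j2) i' s i j1 *
  (m + n - i' == j2)%N%:R.
have Ef : \sum_(i' < (m + n).+1) f i' =
    \sum_(i' < (m + n).+1) f i' * (nat_of_ord i' == (m + n - j2)%N)%:R.
  apply: eq_bigr => -[i' /= im] _; rewrite /f.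
  case: (eqVneq (m + n - i')%N j2) => [E|_]; last by rewrite mulr0 mul0r.
  by rewrite (_ : i' == _) ?mulr1 //; apply/eqP; lia.
transitivity (\sum_(i' < (m + n).+1) f i').
  apply: eq_bigr => i' _; rewrite linearZ /= mcoeffZ -[linext _ _]/(act12 S _).
  by rewrite act12_coef /f; case: eqVneq => [->|_]; rewrite ?mulr1 ?mul1r ?mul0r ?mulr0.
have [j2m|mj2] := leqP j2 (m + n).
  rewrite Ef sum_ord_pick => [|?]; last by lia.
  by rewrite /f subKn // eqxx mulr1.
rewrite Ef big1 => [|[i' /= im] _].
  by rewrite (Tw (m + n - j2)%N j2) ?mul0r //; apply/eqP; lia.
by rewrite /f (_ : _ == j2 = false) ?mulr0 ?mul0r //; apply/eqP; lia.
Qed.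

End Fusion.

(** * Regularity at X = 0 is inherited by fusion *)

Section Regularity.
Context {R : realType}.
Local Notation C := R[i].
Context (eta : C) (Heta : 0 < complex.Im eta).
Local Notation q := (qpow eta).
Implicit Types (A B D : C).

Lemma qpow2_inv : q 2 * q (- 2) = 1.
Proof. exact: qpowVr. Qed.

Lemma qfac_neq0 n : qfac (q (- 2)) n != 0.
Proof.
elim: n => [|n IHn]; first by rewrite qfac0 oner_eq0.
rewrite qfacS mulf_neq0 // subr_eq0 eq_sym; apply/eqP => E.
have := qpow_nat_inj eta Heta 1 n.+1 0; rewrite muln0 expr0 => /(_ _) F.
suff: n.+1 = 0%N by [].
apply: F; rewrite exprM -qpow_nat.
by rewrite -[LHS]mulr1 -[X in _ * X = _]E -exprMn qpow2_inv expr1n.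
Qed.

Definition asymR_coef A := asym_coef (q (- 2)) (q 2) (q (- (2 * A))).

Lemma qpow_weight_add A B : q (- (2 * (A + B))) = q (- (2 * A)) * q (- (2 * B)).
Proof. by rewrite -qpowD; congr q; ring. Qed.

Lemma qpow_weight_nat a : q (- (2 * a%:R)) = q (- 2) ^+ a.
Proof. by rewrite -qpowMn; congr q; ring. Qed.

(** The indices of a basis of M_A, or of its quotient L_a when A = a. *)
Definition basis_range A (P : pred nat) :=
  (forall i, P i) \/ (exists2 a, A = a%:R & forall i, P i = (i <= a)%N).

Context (RR : dyn_family R) (HRR : dynamical_R eta RR).

(** The matrix elements that leave the maximal submodule vanish on both sides of
    the comparison.  Hence in a fusion sum with target inside the range the
    intermediate indices outside the range, where nothing is known, do not
    matter; the same holds for the second factor. *)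
Lemma out_of_range1 A B P m n i j : basis_range A P -> P i -> ~~ P m ->
  generic eta (fun l => mxelt (RR A B l) m n i j = 0) /\
  asymR_coef A m n i j = 0.
Proof.
move=> [PT|[a -> Pa]]; first by rewrite !PT.
rewrite !Pa -ltnNge => ia am; split.
  by apply: (dyn_descend _ _ HRR); left; exists a; rewrite ?ia.
by rewrite /asymR_coef qpow_weight_nat (asym_coef_descend1 _ _ qpow2_inv) // ia.
Qed.

Lemma out_of_range2 A B P m n i j : basis_range B P -> P j -> ~~ P n ->
  generic eta (fun l => mxelt (RR A B l) m n i j = 0) /\
  asymR_coef A m n i j = 0.
Proof.
move=> [PT|[a -> Pa]]; first by rewrite !PT.
rewrite !Pa -ltnNge => ia am; split.
  by apply: (dyn_descend _ _ HRR); right; exists a; rewrite ?ia.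
exact: asym_coef_small (leq_ltn_trans ia am).
Qed.

Lemma value_at0_generic0 (f : C -> C) :
  generic eta (fun l => f l = 0) -> value_at0 eta f 0.
Proof.
move=> f0; apply: value_at0_ext (value_at0_const eta 0).
by apply: generic_mono f0.
Qed.

(** The bound M on the total degree, which fusion preserves, makes the
    condition concern finitely many matrix elements, so that finitely many
    exceptional curves have to be avoided later. *)
Definition asym_regular A B (P Q : pred nat) (M : nat) :=
  forall m n i j : nat, (m + n <= M)%N -> P i -> Q j ->
  value_at0 eta (fun l => mxelt (RR A B l) m n i j) (asymR_coef A m n i j).

Lemma mxelt_fusion12 A B D m n i1 i2 j :
  generic eta (fun l => mxelt (RR (A + B) D l) m n (i1 + i2) j =
    \sum_(s < m.+1)
      mxelt (RR A D (l - weight B (m - s))) s n i1 (s + n - i1) *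
      mxelt (RR B D l) (m - s) (s + n - i1) i2 j).
Proof.
have Gw := generic_forall eta _ _ (fun s : 'I_m.+1 =>
  generic_shift eta _ (weight B (m - s)) (dyn_weight _ _ HRR A D s n)).
have Gf := dyn_fusion12 _ _ HRR A B D (vb2 (A + B) D m n).
apply: generic_mono (generic_and _ _ _ Gw Gf) => l [lw].
move=> /(congr1 (mcoeff (i1, i2, j))).
rewrite gamma12_coef gamma12_vb => E; rewrite /mxelt E.
rewrite /act13 linear_sum /act23 linear_sum raddf_sum; apply: eq_bigr => s _.
exact: (act23_act13_coef A B D (fun=> RR B D l)
  (fun m2 => RR A D (l - weight B m2)) _ _ _ _ _ _ (lw s)).
Qed.

Lemma mxelt_fusion23 A B D m n i j1 j2 :
  generic eta (fun l => mxelt (RR A (B + D) l) m n i (j1 + j2) =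
    \sum_(s < n.+1)
      mxelt (RR A D l) m (n - s) (m + (n - s) - j2) j2 *
      mxelt (RR A B (l - weight D j2)) (m + (n - s) - j2) s i j1).
Proof.
have Gw := dyn_weight _ _ HRR A D m.
have Gw' := generic_forall eta _ _ (fun s : 'I_n.+1 => Gw (n - s)%N).
have Gf := dyn_fusion23 _ _ HRR A B D (vb2 A (B + D) m n).
apply: generic_mono (generic_and _ _ _ Gw' Gf) => l [lw].
move=> /(congr1 (mcoeff (i, j1, j2))).
rewrite gamma23_coef gamma23_vb => E; rewrite /mxelt E.
rewrite /act13 linear_sum /act12 linear_sum raddf_sum; apply: eq_bigr => s _.
exact: (act12_act13_coef A B D (fun m3 => RR A B (l - weight D m3))
  (fun=> RR A D l) _ _ _ _ _ _ (lw s)).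
Qed.

Lemma asymR_coef_fusion12 A B m n i1 i2 j : (i1 + i2 + j = m + n)%N ->
  asymR_coef (A + B) m n (i1 + i2) j =
  \sum_(s < m.+1) asymR_coef A s n i1 (s + n - i1) *
                  asymR_coef B (m - s) (s + n - i1) i2 j.
Proof.
move=> E; rewrite /asymR_coef qpow_weight_add.
by rewrite asym_coef_fusion12 ?qpow2_inv //; apply: qfac_neq0.
Qed.

Lemma asymR_coef_fusion23 A m n i j1 j2 : (i + j1 + j2 = m + n)%N ->
  asymR_coef A m n i (j1 + j2) =
  \sum_(s < n.+1) asymR_coef A m (n - s) (m + (n - s) - j2) j2 *
                  asymR_coef A (m + (n - s) - j2) s i j1.
Proof.
move=> E; rewrite /asymR_coef asym_coef_fusion23 ?qpow2_inv //.
rewrite (reindex_inj rev_ord_inj) /=; apply: eq_bigr => -[s /= sn] _.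
by rewrite subSS subKn.
Qed.

(** Both sides obey the same fusion formula.  A summand either has regular
    factors, or its intermediate index lies outside the range Q and the summand
    vanishes on both sides although its first factor may be singular. *)
Lemma asym_regular_fusion12 A B D (PA PB P Q : pred nat) M : basis_range D Q ->
  (forall i, P i -> exists i1 i2, [/\ i = (i1 + i2)%N, PA i1 & PB i2]) ->
  asym_regular A D PA Q M -> asym_regular B D PB Q M -> asym_regular (A + B) D P Q M.
Proof.
move=> DQ PS regA regB m n i j mnM Pi Qj.
have [E|nE] := eqVneq (m + n)%N (i + j)%N; last first.
  rewrite /asymR_coef asym_coef_weight //; apply: value_at0_generic0.
  by apply: generic_mono (dyn_weight _ _ HRR (A + B) D m n) => l; apply.
have [i1 [i2 [Ei Pi1 Pi2]]] := PS i Pi; subst i.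
rewrite asymR_coef_fusion12 //.
apply: (value_at0_ext eta (fun l => \sum_(s < m.+1)
      mxelt (RR A D (l - weight B (m - s))) s n i1 (s + n - i1) *
      mxelt (RR B D l) (m - s) (s + n - i1) i2 j)).
  by apply: generic_mono (mxelt_fusion12 A B D m n i1 i2 j) => l ->.
apply: (value_at0_sum eta m.+1 (fun s l =>
   mxelt (RR A D (l - weight B (m - s))) s n i1 (s + n - i1) *
   mxelt (RR B D l) (m - s) (s + n - i1) i2 j)) => -[s /= sm].
have [Qs|nQs] := boolP (Q (s + n - i1)%N).
  apply: value_at0_mul; last by apply: regB => //; lia.
  apply: (value_at0_shift eta (fun l => mxelt (RR A D l) _ _ _ _)).
  by apply: regA => //; lia.
have [G0 ->] := out_of_range2 B D Q (m - s) (s + n - i1) i2 j DQ Qj nQs.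
rewrite mulr0; apply: value_at0_generic0.
by apply: generic_mono G0 => l ->; rewrite mulr0.
Qed.

Lemma asym_regular_fusion23 A B D (P QB QD Q : pred nat) M : basis_range A P ->
  (forall j, Q j -> exists j1 j2, [/\ j = (j1 + j2)%N, QB j1 & QD j2]) ->
  asym_regular A B P QB M -> asym_regular A D P QD M -> asym_regular A (B + D) P Q M.
Proof.
move=> AP PS regB regD m n i j mnM Pi Qj.
have [E|nE] := eqVneq (m + n)%N (i + j)%N; last first.
  rewrite /asymR_coef asym_coef_weight //; apply: value_at0_generic0.
  by apply: generic_mono (dyn_weight _ _ HRR A (B + D) m n) => l; apply.
have [j1 [j2 [Ej Qj1 Qj2]]] := PS j Qj; subst j.
rewrite asymR_coef_fusion23 //; last by lia.
apply: (value_at0_ext eta (fun l => \sum_(s < n.+1)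
      mxelt (RR A D l) m (n - s) (m + (n - s) - j2) j2 *
      mxelt (RR A B (l - weight D j2)) (m + (n - s) - j2) s i j1)).
  by apply: generic_mono (mxelt_fusion23 A B D m n i j1 j2) => l ->.
apply: (value_at0_sum eta n.+1 (fun s l =>
   mxelt (RR A D l) m (n - s) (m + (n - s) - j2) j2 *
      mxelt (RR A B (l - weight D j2)) (m + (n - s) - j2) s i j1)) => -[s /= sn].
have [Ps|nPs] := boolP (P (m + (n - s) - j2)%N).
  apply: value_at0_mul; first by apply: regD => //; lia.
  apply: (value_at0_shift eta (fun l => mxelt (RR A B l) _ _ _ _)).
  by apply: regB => //; lia.
have [G0 ->] := out_of_range1 A B P (m + (n - s) - j2) s i j1 AP Pi nPs.
rewrite mulr0; apply: value_at0_generic0.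
apply: generic_mono (generic_shift _ _ (weight D j2) G0) => l ->.
by rewrite mulr0.
Qed.

End Regularity.

(** * Positive integer weights *)

Section Integers.
Context {R : realType}.
Local Notation C := R[i].
Context (eta : C) (Heta : 0 < complex.Im eta).
Local Notation q := (qpow eta).
Implicit Types (A B D : C).
Context (RR : dyn_family R) (HRR : dynamical_R eta RR).

Lemma qpow1_sub_neq0 : q 1 - q (- 1) != 0.
Proof.
have := qfac_neq0 eta Heta 1; rewrite qfacS qfac0 mul1r.
apply: contraNneq => E.
have : q (- 1) * (q 1 - q (- 1)) = 0 by rewrite E mulr0.
by rewrite mulrBr -!qpowD addNr qpow0 expr1 => <-; apply/eqP; congr (_ - q _); ring.
Qed.

(** Multiplying numerator and denominator by q^l turns quotients of q-numbers
    into fractions in X = q^(2l) with denominator X - 1, regular at X = 0. *)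
Lemma qbr_ratio l c : qbr eta (l + c) / qbr eta l =
  (q c * q (2 * l) - q (- c)) / (q (2 * l) - 1).
Proof.
have d0 := qpow1_sub_neq0; have ql := qpow_neq0 eta l.
rewrite /qbr invfM invrK mulrACA mulVf // mulr1.
have -> : q c * q (2 * l) - q (- c) = (q (l + c) - q (- (l + c))) * q l.
  by rewrite mulrBl -!qpowD; congr (q _ - q _); ring.
have -> : q (2 * l) - 1 = (q l - q (- l)) * q l.
  by rewrite mulrBl -!qpowD addNr qpow0; congr (q _ - _); ring.
by rewrite -mulf_div divff // mulr1.
Qed.

Lemma scaled_qbr_ratio s l c c' : - c = c' ->
  s * qbr eta (l + c) / qbr eta l =
  (s * q c * q (2 * l) - s * q c') / (q (2 * l) - 1).
Proof.
move=> <-; rewrite -mulrA qbr_ratio.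
by move: (q c) (q (- c)) (q (2 * l)) (_^-1) => a b x d; ring.
Qed.

Lemma qbr_inv l a : a / qbr eta l =
  a * (q 1 - q (- 1)) * q l / (q (2 * l) - 1).
Proof.
have ql := qpow_neq0 eta l.
have -> : q (2 * l) - 1 = (q l - q (- l)) * q l.
  by rewrite mulrBl -!qpowD addNr qpow0; congr (q _ - _); ring.
by rewrite -mulf_div divff // mulr1 /qbr invf_div mulrA.
Qed.

Lemma value_at0_linfrac (a b : C) :
  value_at0 eta (fun l => (a * q (2 * l) + b) / (q (2 * l) - 1)) (- b).
Proof.
have N0 : ('X - 1%:P : {poly C}).[0] != 0.
  by rewrite hornerXsubC sub0r oppr_eq0 oner_eq0.
have := value_at0_frac eta (a *: 'X + b%:P) _ N0.
rewrite !hornerE invrN invr1 mulrN1.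
by apply: value_at0_eq => l; rewrite hornerXsubC !hornerE.
Qed.

Lemma mcoeff_vb2_comb A B (a b : C) m n m' n' i j :
  (a *: vb2 A B m n + b *: vb2 A B m' n')@_(i, j) =
  a * ((m == i) && (n == j))%:R + b * ((m' == i) && (n' == j))%:R.
Proof.
rewrite -(mcoeff_vb2 A B m n) -(mcoeff_vb2 A B m' n').
etransitivity; first exact: mcoeffD.
by congr (_ + _); exact: mcoeffZ.
Qed.

(** The fundamental R-matrix at X = 0. *)
Lemma asym_regular11 M :
  asym_regular eta RR 1%:R 1%:R (fun i => i <= 1)%N (fun j => j <= 1)%N M.
Proof.
have range1 : basis_range (1%:R : C) (fun i => i <= 1)%N by right; exists 1%N.
have lift0 (f : C -> C) c : (generic eta (fun l => f l = 0) /\ c = 0) ->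
    value_at0 eta f c.
  by move=> [G ->]; apply: value_at0_generic0.
move=> m n i j _ i1 j1.
have [m1|m1] := leqP m 1; last first.
  apply: lift0; apply: (out_of_range1 eta RR HRR 1%:R 1%:R _ m n i j range1 i1).
  by rewrite -ltnNge.
have [n1|n1] := leqP n 1; last first.
  apply: lift0; apply: (out_of_range2 eta RR HRR 1%:R 1%:R _ m n i j range1 j1).
  by rewrite -ltnNge.
have [E|nE] := eqVneq (m + n)%N (i + j)%N; last first.
  rewrite /asymR_coef asym_coef_weight //; apply: value_at0_generic0.
  by apply: generic_mono (dyn_weight _ _ HRR 1%:R 1%:R m n) => l; apply.
have Gf := dyn_fundamental _ _ HRR.
have qq1 : q (- 1) * q (- 1) = q (- 2) by rewrite -qpowD; congr q; ring.
have qq2 : q (- 1) * q 1 = 1 by rewrite -qpowD addNr qpow0.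
case: m n i j m1 n1 i1 j1 E => [|[|//]] [|[|//]] [|[|//]] [|[|//]] // _ _ _ _ _;
  rewrite /asymR_coef qpow_weight_nat expr1 /asym_coef /=
    ?(qpoch_geq _ _ _ _ (leqnn _)) ?(qpoch_geq _ _ _ _ (leq0n _))
    ?mulr1 ?mulr0 ?mul1r ?expr1 ?expr0 ?add0r ?mulr1.
- apply: (value_at0_ext eta (fun=> 1)); last exact: value_at0_const.
  apply: generic_mono Gf => l [/(_ 0 0)%N H _ _ _].
  by rewrite /mxelt H // mcoeff_vb2.
- have H := value_at0_linfrac (q (- 1) * q 1) (- (q (- 1) * q (- 1))).
  rewrite opprK [X in value_at0 _ _ X]qq1 in H; apply: (value_at0_ext _ _ _ _ _ H).
  apply: generic_mono Gf => l [_ _ /(_ 0 1)%N G _].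
  rewrite /mxelt G // mcoeff_vb2_comb /= mulr1 mulr0 addr0.
  by rewrite (scaled_qbr_ratio _ _ _ (- 1)).
- have H := value_at0_linfrac (q (- 1) * (q 1 - q (- 1))) 0.
  rewrite oppr0 in H; apply: (value_at0_ext _ _ _ _ _ H).
  apply: generic_mono Gf => l [_ _ /(_ 1 0)%N G _].
  rewrite /mxelt G // mcoeff_vb2_comb /= mulr1 mulr0 add0r.
  rewrite qbr_inv addr0; congr (_ / _).
  have -> : q (2 * l) = q l * q l by rewrite -qpowD; congr q; ring.
  by rewrite qpowD; ring.
- have H := value_at0_linfrac 0 (- (q (- 1) * (q 1 - q (- 1)))).
  rewrite opprK [X in value_at0 _ _ X]mulrBr qq1 qq2 in H.
  rewrite /qpoch big_nat1 expr0 mulr1; apply: (value_at0_ext _ _ _ _ _ H).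
  apply: generic_mono Gf => l [_ _ _ /(_ 0 1)%N G].
  rewrite /mxelt G // mcoeff_vb2_comb /= mulr1 mulr0 addr0.
  rewrite qbr_inv mul0r add0r -[RHS]mulNr; congr (_ / _).
  have -> : q (- l - 1) = q (- l) * q (- 1) by rewrite -qpowD.
  have ll : q (- l) * q l = 1 by rewrite -qpowD addNr qpow0.
  by ring: ll.
- have H := value_at0_linfrac (q (- 1) * q (- 1)) (- (q (- 1) * q 1)).
  rewrite opprK [X in value_at0 _ _ X]qq2 in H; apply: (value_at0_ext _ _ _ _ _ H).
  apply: generic_mono Gf => l [_ _ _ /(_ 1 0)%N G].
  rewrite /mxelt G // mcoeff_vb2_comb /= mulr1 mulr0 add0r.
  by rewrite (scaled_qbr_ratio _ _ _ 1) ?opprK.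
- rewrite mulrC qpow2_inv.
  apply: (value_at0_ext eta (fun=> 1)); last exact: value_at0_const.
  apply: generic_mono Gf => l [_ /(_ 1 1)%N H _ _].
  by rewrite /mxelt H // mcoeff_vb2.
Qed.

(** Fusion with the weight 1: an index up to a + 2 is the sum of an index up to
    a + 1 and one up to 1. *)
Lemma asym_regular_nat a b M :
  asym_regular eta RR a.+1%:R b.+1%:R (fun i => i <= a.+1)%N (fun j => j <= b.+1)%N M.
Proof.
have range n : basis_range (n%:R : C) (fun i => i <= n)%N by right; exists n.
have natS n : n.+2%:R = n.+1%:R + 1%:R :> C by rewrite -natrD addn1.
have cut n i : (i <= n.+2)%N ->
    exists i1 i2, [/\ i = (i1 + i2)%N, (i1 <= n.+1)%N & (i2 <= 1)%N].
  by move=> ?; exists (minn i n.+1), (i - minn i n.+1)%N; split; lia.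
elim: b => [|b IHb].
  elim: a => [|a IHa]; first exact: asym_regular11.
  rewrite natS.
  by apply: (asym_regular_fusion12 eta Heta RR HRR _ _ _ _ _ _ _ _
    (range 1%N) (cut a) IHa (asym_regular11 _)).
rewrite natS.
apply: (asym_regular_fusion23 eta Heta RR HRR _ _ _ _ _ _ _ _
  (range a.+1) (cut b) IHb).
elim: {IHb} a => [|a IHa]; first exact: asym_regular11.
rewrite natS.
by apply: (asym_regular_fusion12 eta Heta RR HRR _ _ _ _ _ _ _ _
    (range 1%N) (cut a) IHa (asym_regular11 _)).
Qed.

End Integers.

(** * From integer weights to all weights *)

Section Bivariate.
Context {F : idomainType}.

Lemma poly2_eq0_infinite (W : {poly {poly F}}) (f : nat -> F) K1 K2 :
  injective f ->
  (forall a b : nat, (K1 <= a)%N -> (K2 <= b)%N -> W.[(f b)%:P].[f a] = 0) ->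
  W = 0.
Proof.
move=> finj W0; apply: (poly_eq0_infinite _ (fun b => (f b)%:P) K2).
  by move=> a b /polyC_inj /finj.
move=> b Kb; apply: (poly_eq0_infinite _ f K1) => // a Ka.
exact: W0.
Qed.

End Bivariate.

Section Rationality.
Context {R : realType}.
Local Notation C := R[i].
Context (eta : C) (Heta : 0 < complex.Im eta).
Local Notation q := (qpow eta).
Implicit Types (A B D : C).

Definition spec2 (x y : C) : {rmorphism {poly {poly C}} -> C} :=
  horner_eval x \o horner_eval y%:P.

Lemma spec2E x y W : spec2 x y W = W.[y%:P].[x].
Proof. by []. Qed.

Lemma spec2M x y U V : spec2 x y (U * V) = spec2 x y U * spec2 x y V.
Proof. exact: rmorphM. Qed.

Lemma spec2B x y U V : spec2 x y (U - V) = spec2 x y U - spec2 x y V.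
Proof. exact: rmorphB. Qed.

Lemma spec2_0 x y : spec2 x y 0 = 0.
Proof. exact: rmorph0. Qed.

Lemma coef_spec2 x y (p : {poly {poly {poly C}}}) e :
  (map_poly (spec2 x y) p)`_e = spec2 x y p`_e.
Proof. exact: coef_map. Qed.

Lemma eval3_map (p : {poly {poly {poly C}}}) x y z :
  eval3 p x y z = (map_poly (spec2 x y) p).[z].
Proof.
transitivity (map_poly (spec2 x y) p).[spec2 x y z%:P%:P].
  by rewrite horner_map.
by rewrite spec2E !hornerC.
Qed.

Lemma drop_poly_val (N : {poly C}) d : (forall e, (e < d)%N -> N`_e = 0) ->
  N = drop_poly d N * 'X^d.
Proof.
move=> N0; rewrite -[LHS](poly_take_drop d) [X in X + _](_ : _ = 0) ?add0r //.
apply/polyP => e; rewrite coef_take_poly coef0.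
by case: ifP => // /N0.
Qed.

Lemma drop_poly_at0 (N : {poly C}) d : (drop_poly d N).[0] = N`_d.
Proof. by rewrite horner_coef0 coef_drop_poly. Qed.

(** If X^d is the exact power of X dividing D, regularity of N / D at 0 forces
    X^d to divide N, and the value is the quotient of the coefficients of X^d. *)
Lemma value_at0_valuation (f : C -> C) (N D : {poly C}) d t :
  D`_d != 0 -> (forall e, (e < d)%N -> D`_e = 0) ->
  generic eta (fun l => f l = N.[q (2 * l)] / D.[q (2 * l)]) ->
  value_at0 eta f t ->
  (forall e, (e < d)%N -> N`_e = 0) /\ N`_d = t * D`_d.
Proof.
move=> Dd Dlow fND [N1 [D1 [D10 fN1 ->]]].
have D0 : D != 0 by apply: contraNneq Dd => ->; rewrite coef0.
have E : N * D1 = N1 * D.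
  apply: (generic_poly_eq eta Heta).
  have GD := generic_neq0 eta _ D0.
  have GD' := generic_neq0 eta _ (horner0_neq0 _ D10).
  move: (generic_and _ _ _ (generic_and _ _ _ fND fN1) (generic_and _ _ _ GD GD')).
  apply: generic_mono => l [[-> ] E [Dl D'l]].
  by rewrite !hornerM; apply/eqP; rewrite -eqr_div ?E.
rewrite (drop_poly_val _ _ Dlow) mulrA in E.
have XdN : ('X^d %| N)%R.
  rewrite -(Gauss_dvdpl N (q := D1)); first by rewrite E dvdp_mull.
  apply: coprimep_expl.
  by rewrite coprimep_sym coprimepX.
have Nlow e : (e < d)%N -> N`_e = 0.
  by move=> ed; have /dvdpP[N' ->] := XdN; rewrite coefMXn ed.
split=> //; rewrite (drop_poly_val _ _ Nlow) mulrAC in E.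
have Xd0 : ('X^d : {poly C}) != 0 by rewrite monic_neq0 ?monicXn.
have E' := mulIf Xd0 E.
have := congr1 (horner^~ 0) E'; rewrite /= !hornerM !drop_poly_at0 => E0.
by rewrite -[LHS](mulfK D10) E0 mulrAC.
Qed.

Lemma valuation_value_at0 (f : C -> C) (N D : {poly C}) d t :
  D`_d != 0 -> (forall e, (e < d)%N -> D`_e = 0) ->
  generic eta (fun l => f l = N.[q (2 * l)] / D.[q (2 * l)]) ->
  (forall e, (e < d)%N -> N`_e = 0) -> N`_d = t * D`_d ->
  value_at0 eta f t.
Proof.
move=> Dd Dlow fND Nlow Nd; exists (drop_poly d N), (drop_poly d D).
rewrite !drop_poly_at0 Nd mulfK //; split=> //.
apply: generic_mono fND => l ->.
rewrite {1}(drop_poly_val _ _ Nlow) {1}(drop_poly_val _ _ Dlow) !hornerM.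
by rewrite -mulf_div divff ?mulr1 // hornerXn expf_neq0 // qpow_neq0.
Qed.

Lemma qpoch_poly r i m : exists tau : {poly C}, forall x, x != 0 ->
  qpoch r (x ^- 2) i m * (x ^+ 2) ^+ (m - i) = tau.[x].
Proof.
exists (\prod_(i <= s < m) ('X^2 - (r ^+ s)%:P)) => x x0.
rewrite horner_prod /qpoch -prodr_const_nat -big_split /=.
apply: eq_bigr => s _; rewrite hornerD hornerN hornerXn hornerC.
rewrite mulrBl mul1r mulrAC mulVf ?mul1r //.
by rewrite expf_neq0.
Qed.

(** Up to a power of q^A, the coefficients are polynomials in q^A. *)
Lemma asymR_coef_poly m n i j : exists (tau : {poly C}) e, forall A,
  asymR_coef eta A m n i j * q A ^+ e = tau.[q A].
Proof.
have [E|nE] := eqVneq (m + n)%N (i + j)%N; last first.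
  exists 0, 0%N => A; rewrite /asymR_coef asym_coef_weight // mul0r horner0 //.
have [tau Htau] := qpoch_poly (q 2) i m.
exists ((q 2 ^+ m) ^+ n * gbin (q (- 2)) j n *: tau), (2 * n + 2 * (m - i))%N => A.
rewrite /asymR_coef /asym_coef ifT ?E // hornerZ -(Htau _ (qpow_neq0 _ _)).
have -> : q (- (2 * A)) = q A ^- 2.
  by rewrite qpowN; congr (_^-1); rewrite -qpowMn mulrC.
have qA : q A ^- 2 ^+ n * q A ^+ (2 * n) = 1.
  by rewrite exprM -exprMn mulVf ?expr1n // expf_neq0 // qpow_neq0.
rewrite exprD exprMn [q A ^+ (2 * (m - i))]exprM.
rewrite -[RHS]mul1r -qA; ring.
Qed.

Local Notation sp A B := (spec2 (q A) (q B)).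

Context (RR : dyn_family R) (HRR : dynamical_R eta RR).

(** Let X^d be the exact power of X dividing the denominator D over the ring of
    polynomials in x = q^A and y = q^B.  At the integer points where the
    coefficient D_d(x, y) does not vanish, [value_at0_valuation] gives N_e = 0
    for e < d and N_d = t D_d, where t is the expected value.  These points are
    Zariski dense, so the relations are identities, and they give back
    regularity wherever D_d(x, y) <> 0. *)
Lemma mxelt_regular_generic m n i j : exists2 Q : {poly {poly C}}, Q != 0 &
  forall A B, spec2 (q A) (q B) Q != 0 ->
  value_at0 eta (fun l => mxelt (RR A B l) m n i j) (asymR_coef eta A m n i j).
Proof.
have [N [D ND]] := dyn_rational _ _ HRR m n i j.
have D0 A B : map_poly (sp A B) D != 0.
  have [[l Dl] _] := ND A B.
  by apply: contraNneq Dl => E; rewrite eval3_map E horner0.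
have fND A B : generic eta (fun l => mxelt (RR A B l) m n i j =
    (map_poly (sp A B) N).[q (2 * l)] / (map_poly (sp A B) D).[q (2 * l)]).
  have [_ H] := ND A B; exists (map_poly (sp A B) D); split=> // l Dl.
  by rewrite H !eval3_map.
have exd : exists d, D`_d != 0.
  exists (size D).-1; rewrite -[_`_ _]/(lead_coef D) lead_coef_eq0.
  by apply: contraNneq (D0 0 0) => ->; rewrite rmorph0.
have [d Dd dmin] := ex_minnP exd.
have Dlow e : (e < d)%N -> D`_e = 0.
  by move=> ed; apply/eqP; apply: contraTT ed => /dmin; rewrite -leqNgt.
have DlowAB A B e : (e < d)%N -> (map_poly (sp A B) D)`_e = 0.
  by move=> ed; rewrite coef_spec2 Dlow // spec2_0.
have [tau [c Htau]] := asymR_coef_poly m n i j.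
pose f k := q 1 ^+ k.
have finj : injective f.
  by move=> k k'; have := @qpow_nat_inj _ eta Heta 0 k k'; rewrite !mul1n.
have nat_val a b : (maxn i 1 <= a)%N -> (maxn j 1 <= b)%N ->
    spec2 (f a) (f b) D`_d != 0 ->
    (forall e, (e < d)%N -> spec2 (f a) (f b) N`_e = 0) /\
    spec2 (f a) (f b) N`_d = asymR_coef eta a%:R m n i j * spec2 (f a) (f b) D`_d.
  rewrite /f -!qpow_nat => ia jb Dab.
  have [||Nlow Nd] := value_at0_valuation _ (map_poly (sp a%:R b%:R) N)
     (map_poly (sp a%:R b%:R) D) d (asymR_coef eta a%:R m n i j) _ (DlowAB _ _) (fND _ _).
  - by rewrite coef_spec2.
  - have [a' Ea] : exists a', a = a'.+1 by exists a.-1; lia.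
    have [b' Eb] : exists b', b = b'.+1 by exists b.-1; lia.
    subst a b; apply: (asym_regular_nat eta Heta RR HRR _ _ (m + n)) => //; lia.
  - split=> [e /Nlow|]; by [rewrite coef_spec2 | move: Nd; rewrite !coef_spec2].
have Nlow e : (e < d)%N -> N`_e = 0.
  move=> ed; apply/eqP; suff: N`_e * D`_d == 0 by rewrite mulf_eq0 (negbTE Dd) orbF.
  apply/eqP/(poly2_eq0_infinite _ f (maxn i 1) (maxn j 1) finj) => a b ia jb.
  rewrite -spec2E spec2M; have [->|Dab] := eqVneq (spec2 (f a) (f b) D`_d) 0.
    by rewrite mulr0.
  by have [low _] := nat_val a b ia jb Dab; rewrite low // mul0r.
have Nd : N`_d * ('X^c)%:P = tau%:P * D`_d.
  apply/eqP; rewrite -subr_eq0.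
  suff: (N`_d * ('X^c)%:P - tau%:P * D`_d) * D`_d == 0.
    by rewrite mulf_eq0 (negbTE Dd) orbF.
  apply/eqP/(poly2_eq0_infinite _ f (maxn i 1) (maxn j 1) finj) => a b ia jb.
  rewrite -spec2E spec2M; have [->|Dab] := eqVneq (spec2 (f a) (f b) D`_d) 0.
    by rewrite mulr0.
  have [_ E] := nat_val a b ia jb Dab.
  rewrite spec2B.
  rewrite !spec2M.
  rewrite E.
  rewrite ![spec2 _ _ _%:P]spec2E.
  rewrite !hornerC hornerXn.
  have <- : asymR_coef eta a%:R m n i j * f a ^+ c = tau.[f a].
    by have := Htau a%:R; rewrite qpow_nat.
  by ring.
exists D`_d => // A B DAB.
apply: (valuation_value_at0 _ (map_poly (sp A B) N) (map_poly (sp A B) D) d) => //.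
- by rewrite coef_spec2.
- exact: DlowAB.
- by move=> e ed; rewrite coef_spec2 Nlow // spec2_0.
rewrite !coef_spec2; apply: (mulIf (expf_neq0 c (qpow_neq0 eta A))).
have := congr1 (sp A B) Nd; rewrite !spec2M.
rewrite !spec2E !hornerC hornerXn => ->.
by rewrite -Htau; ring.
Qed.

Lemma asym_regular_generic M : exists2 Q : {poly {poly C}}, Q != 0 &
  forall A B, spec2 (q A) (q B) Q != 0 -> asym_regular eta RR A B xpredT xpredT M.
Proof.
pose T : finType := ('I_M.+1 * 'I_M.+1 * 'I_M.+1 * 'I_M.+1)%type.
have HQ0 (x : T) : exists Q : {poly {poly C}}, Q != 0 /\
    forall A B, spec2 (q A) (q B) Q != 0 ->
    value_at0 eta (fun l => mxelt (RR A B l) x.1.1.1 x.1.1.2 x.1.2 x.2)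
      (asymR_coef eta A x.1.1.1 x.1.1.2 x.1.2 x.2).
  by have [Q Q0 HQ] := mxelt_regular_generic x.1.1.1 x.1.1.2 x.1.2 x.2; exists Q.
have [Q HQ] := fin_all_exists HQ0.
exists (\prod_x Q x) => [|A B QAB].
  by apply/prodf_neq0 => x _; case: (HQ x).
move=> m n i j mn _ _.
have [E|nE] := eqVneq (m + n)%N (i + j)%N; last first.
  rewrite /asymR_coef asym_coef_weight //; apply: value_at0_generic0.
  by apply: generic_mono (dyn_weight _ _ HRR A B m n) => l; apply.
have mM : (m < M.+1)%N by lia.
have nM : (n < M.+1)%N by lia.
have iM : (i < M.+1)%N by lia.
have jM : (j < M.+1)%N by lia.
have [_] := HQ (Ordinal mM, Ordinal nM, Ordinal iM, Ordinal jM).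
apply; move: QAB; rewrite rmorph_prod => /prodf_neq0; exact.
Qed.

(** Write A = k + (A - k) and B = l + (B - l).  The bad locus of
    [asym_regular_generic] is a curve, so natural numbers l, and then k, can be
    chosen such that the four pairs of summands avoid it. *)
Lemma asym_regular_all A B M : asym_regular eta RR A B xpredT xpredT M.
Proof.
have [Q Q0 HQ] := asym_regular_generic M.
have inj1 : injective (fun k : nat => q k%:R).
  move=> k k'; rewrite !qpow_nat => E.
  by apply: (@qpow_nat_inj _ eta Heta 0); rewrite !mul1n.
have inj2 D : injective (fun k : nat => q (D - k%:R)).
  by move=> k k'; rewrite !qpowB => /(mulfI (qpow_neq0 _ _)) /invr_inj /inj1.
have ev1 (W : {poly C}) D : W != 0 ->
    exists K : nat, forall k : nat, (K <= k)%N -> W.[q k%:R] != 0 /\ W.[q (D - k%:R)] != 0.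
  move=> W0; have [K1 H1] := horner_eventually_neq0 _ _ inj1 W0.
  have [K2 H2] := horner_eventually_neq0 _ _ (inj2 D) W0.
  exists (maxn K1 K2) => k; rewrite geq_max => /andP[k1 k2].
  by split; [apply: H1 | apply: H2].
have [l [Ql Ql']] : exists l : nat,
    Q.[(q l%:R)%:P] != 0 /\ Q.[(q (B - l%:R))%:P] != 0.
  have [K1 H1] := horner_eventually_neq0 Q (fun k : nat => (q k%:R)%:P)
    (inj_comp polyC_inj inj1) Q0.
  have [K2 H2] := horner_eventually_neq0 Q (fun k : nat => (q (B - k%:R))%:P)
    (inj_comp polyC_inj (inj2 B)) Q0.
  by exists (maxn K1 K2); split; [apply/H1/leq_maxl | apply/H2/leq_maxr].
have [K1 H1] := ev1 _ A Ql; have [K2 H2] := ev1 _ A Ql'.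
pose k := maxn K1 K2.
have [H1k H1k'] := H1 k (leq_maxl _ _); have [H2k H2k'] := H2 k (leq_maxr _ _).
have all_range D : basis_range D xpredT by left.
have split0 i : xpredT i ->
    exists i1 i2, [/\ i = (i1 + i2)%N, xpredT i1 & xpredT i2].
  by move=> _; exists i, 0%N; rewrite addn0.
have EA : A = k%:R + (A - k%:R) by rewrite addrC subrK.
have EB : B = l%:R + (B - l%:R) by rewrite addrC subrK.
rewrite EB; apply: (asym_regular_fusion23 eta Heta RR HRR _ _ _ _ _ _ _ _
    (all_range A) split0);
  rewrite EA; apply: (asym_regular_fusion12 eta Heta RR HRR _ _ _ _ _ _ _ _
    (all_range _) split0);
  exact: HQ.
Qed.

End Rationality.

(** * Comparison with the quantum R-matrix *)

Section Comparison.
Context {R : realType}.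
Local Notation C := R[i].
Context (eta : C) (Heta : 0 < complex.Im eta).
Local Notation q := (qpow eta).
Implicit Types (A B D : C).

Lemma verma2_ext A B (V : lmodType C) (f g : {linear verma2 A B -> V}) :
  (forall m n, f (vb2 A B m n) = g (vb2 A B m n)) -> f =1 g.
Proof.
move=> fg t; rewrite (monalgE t) !linear_sum; apply: eq_bigr => -[m n] _.
have -> : << t@_(m, n) *g (m, n) >> = t@_(m, n) *: vb2 A B m n.
  by apply/malgP => j; rewrite mcoeffZ !mcoeffU mulr_natr.
by rewrite !linearZ /= fg.
Qed.

(** The operator with the expected coefficients satisfies the defining property
    of the limit, and values at 0 are unique. *)
Lemma asymptoticR_mxelt (RR : dyn_family R) (HRR : dynamical_R eta RR) A B m n i j :
  mxelt (asymptoticR eta RR A B) m n i j = asymR_coef eta A m n i j.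
Proof.
have reg m' n' i' j' := asym_regular_all eta Heta RR HRR A B (m' + n') m' n' i' j'
  (leqnn _) isT isT.
rewrite /asymptoticR; case: pselect => [ex|[]].
  case: (cid ex) => T HT /=.
  exact: (value_at0_unique eta Heta _ _ _ (HT _ _ _ _) (reg _ _ _ _)).
pose T : {linear verma2 A B -> verma2 A B} :=
  linext (fun x : nat * nat => \sum_(i < (x.1 + x.2).+1)
    asymR_coef eta A x.1 x.2 i (x.1 + x.2 - i) *: vb2 A B i (x.1 + x.2 - i)).
exists T => m' n' i' j'.
rewrite (_ : mxelt T m' n' i' j' = asymR_coef eta A m' n' i' j') //.
rewrite /mxelt /T /= linext_vb2 raddf_sum /=.
pose f i := asymR_coef eta A m' n' i (m' + n' - i) * (m' + n' - i == j')%N%:R.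
transitivity (\sum_(i < (m' + n').+1) f i * (nat_of_ord i == i')%:R).
  apply: eq_bigr => k _; rewrite mcoeffZ mcoeff_vb2 /f -mulrA; congr (_ * _).
  by case: eqVneq; rewrite ?mulr1 ?mulr0.
rewrite sum_ord_pick /f => [|i'n].
  case: eqVneq => [<-|E]; first by rewrite mulr1.
  rewrite mulr0; have [i'm|mi'] := leqP i' (m' + n').
    by rewrite /asymR_coef asym_coef_weight //; apply/eqP; move/eqP: E; lia.
  by rewrite /asymR_coef asym_coef_up //; lia.
by rewrite /asymR_coef asym_coef_up ?mul0r //; lia.
Qed.

Local Notation d := (q 1 - q (- 1)).

(** The dictionary between the factors 1 - p^x and the symmetric q-numbers. *)
Lemma one_sub_qpow x : 1 - q (- (2 * x)) = q (- x) * (d * qbr eta x).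
Proof.
rewrite /qbr [d * _]mulrC divfK ?qpow1_sub_neq0 //.
by rewrite mulrBr -!qpowD addNr qpow0; congr (_ - q _); ring.
Qed.

(** The binomial coefficient binom(k + 1, 2) in C, the sum of the exponents that
    appear when [one_sub_qpow] is applied to (1 - p) ... (1 - p^k). *)
Definition binom2 (k : nat) : C := k%:R * (k%:R + 1) / 2.

Lemma qfac_qfact n : qfac (q (- 2)) n = q (- binom2 n) * d ^+ n * qfact eta n.
Proof.
elim: n => [|n IHn].
  by rewrite qfac0 /qfact big_geq // /binom2 !mul0r oppr0 qpow0 expr0 !mulr1.
rewrite qfacS qfactS IHn -qpowMn mulNr one_sub_qpow exprSr.
have -> : q (- binom2 n.+1) = q (- binom2 n) * q (- n.+1%:R).
  by rewrite -qpowD /binom2 -natr1; congr q; field.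
by ring.
Qed.

Lemma qfact_neq0 n : qfact eta n != 0.
Proof.
by have := qfac_neq0 eta Heta n; rewrite qfac_qfact mulf_eq0 negb_or => /andP[].
Qed.

Lemma gbin_qfact m k : gbin (q (- 2)) (m + k) m =
  q (- (m%:R * k%:R)) * (qfact eta (m + k) / qfact eta m / qfact eta k).
Proof.
have mX := qfac_neq0 eta Heta m; have kX := qfac_neq0 eta Heta k.
have := gbin_qfac (q (- 2)) k m; rewrite addnC => E.
apply: (mulIf mX); apply: (mulIf kX); rewrite E !qfac_qfact.
have -> : q (- binom2 (m + k)) =
    q (- binom2 m) * q (- binom2 k) * q (- (m%:R * k%:R)).
  by rewrite -!qpowD /binom2 natrD; congr q; field.
have m0 := qfact_neq0 m; have k0 := qfact_neq0 k.
rewrite exprD.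
move: (q (- binom2 m)) (q (- binom2 k)) (q (- (m%:R * k%:R))) => x y z.
move: (d ^+ m) (d ^+ k) (qfact eta (m + k)) => a b c.
by field; rewrite m0 k0.
Qed.

Lemma qpoch_qbr A i k : qpoch (q 2) (q (- (2 * A))) i (i + k) =
  q (- (k%:R * (A - i%:R) - k%:R * (k%:R - 1) / 2)) * d ^+ k *
  \prod_(i <= s < i + k) qbr eta (A - s%:R).
Proof.
elim: k => [|k IHk].
  by rewrite addn0 qpoch_geq // big_geq // !mul0r subrr oppr0 qpow0 expr0 !mulr1.
rewrite addnS qpochS ?leq_addr // IHk big_nat_recr ?leq_addr //=.
rewrite (_ : 1 - _ = 1 - q (- (2 * (A - (i + k)%:R)))); last first.
  by rewrite -qpowMn -qpowD; congr (1 - q _); ring.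
rewrite one_sub_qpow.
have -> : q (- (k.+1%:R * (A - i%:R) - k.+1%:R * (k.+1%:R - 1) / 2)) =
   q (- (k%:R * (A - i%:R) - k%:R * (k%:R - 1) / 2)) * q (- (A - (i + k)%:R)).
  by rewrite -qpowD natrD -natr1; congr q; field.
rewrite exprSr.
by ring.
Qed.

Lemma vermaE_iter A i k : iter k (vermaE eta A) (vb A (i + k)) =
  (\prod_(i <= s < i + k) qbr eta (A - s%:R)) *: vb A i.
Proof.
have EZ c j t : iter j (vermaE eta A) (c *: t) = c *: iter j (vermaE eta A) t.
  by elim: j => [//|j]; rewrite !iterS => ->; rewrite vermaE_Z.
elim: k => [|k IHk]; first by rewrite addn0 big_geq // scale1r.
rewrite addnS iterSr vermaE_vb /=.
rewrite EZ IHk; etransitivity; first exact: scalerA.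
by congr (_ *: _); rewrite (big_nat_recr _ _ _ (leq_addr k i)) mulrC.
Qed.

Lemma vermaF_iter A m k : iter k (vermaF eta A) (vb A m) =
  (qfact eta (m + k) / qfact eta m) *: vb A (m + k).
Proof.
elim: k => [|k IHk]; first by rewrite addn0 divff ?qfact_neq0 // scale1r.
rewrite iterS IHk vermaF_Z vermaF_vb scalerA (addnS m k).
by congr (_ *: _); rewrite (qfactS eta (m + k)) mulrAC.
Qed.

Lemma tens_vb A B (a b : C) i j :
  tens (a *: vb A i) (b *: vb B j) = (a * b) *: vb2 A B i j.
Proof. by rewrite /tens linearZ /= linext_vb linearZ /= linext_vb scalerA. Qed.

Lemma quantumR_vb A B n m : quantumR eta A B (vb2 A B n m) =
  \sum_(k < n.+1) (q (- (A * B) / 2) * q (weight A n * weight B m / 2) *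
    (q (k%:R * (k%:R - 1) / 2) * d ^+ k / qfact eta k) *
    (\prod_(n - k <= s < n) qbr eta (A - s%:R)) *
    (qfact eta (m + k) / qfact eta m)) *: vb2 A B (n - k) (m + k).
Proof.
have Ehh : qhh eta A B (vb2 A B n m) =
  q (weight A n * weight B m / 2) *: vb2 A B n m by exact: linext_vb2.
have Eq : quasiR eta A B (vb2 A B n m) = \sum_(k < n.+1)
    (q (k%:R * (k%:R - 1) / 2) * d ^+ k / qfact eta k) *:
    tens (iter k (vermaE eta A) (vb A n)) (iter k (vermaF eta B) (vb B m)).
  exact: linext_vb2.
have EZ c t : quasiR eta A B (c *: t) = c *: quasiR eta A B t.
  exact: linearZ.
rewrite /quantumR /= Ehh EZ Eq scalerA scaler_sumr; apply: eq_bigr => -[k /= kn] _.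
have E1 : iter k (vermaE eta A) (vb A n) =
    (\prod_(n - k <= s < n) qbr eta (A - s%:R)) *: vb A (n - k).
  by have := vermaE_iter A (n - k) k; rewrite subnK.
by rewrite vermaF_iter E1 tens_vb !scalerA; congr (_ *: _); rewrite !mulrA.
Qed.

(** On the left stands quantum R after Xi, on the right Xi after the asymptotic
    R-matrix: both are the same product of q-numbers times a power of q, and
    the exponents coincide. *)
Lemma quantum_asymptotic_coef A B n m k : (k <= n)%N ->
  q (n%:R * (B - m%:R)) * (q (- (A * B) / 2) * q (weight A n * weight B m / 2) *
    (q (k%:R * (k%:R - 1) / 2) * d ^+ k / qfact eta k) *
    (\prod_(n - k <= s < n) qbr eta (A - s%:R)) *
    (qfact eta (m + k) / qfact eta m)) =
  asymR_coef eta A n m (n - k) (m + k) * q ((m + k)%:R * (A - (n - k)%:R)).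
Proof.
move=> kn; have [i En] : exists i, n = (i + k)%N by exists (n - k)%N; lia.
subst n; rewrite addnK /asymR_coef /asym_coef ifT; last by apply/eqP; lia.
rewrite qpoch_qbr gbin_qfact.
have -> : (q (- (2 * A)) * q 2 ^+ (i + k)) ^+ m =
    q ((- (2 * A) + 2 * (i + k)%:R) * m%:R).
  by rewrite -qpowMn -qpowD -qpowMn.
move: (\prod_(_ <= _ < _) _) (d ^+ k) (qfact eta (m + k)) => P dk fmk.
move: (qfact eta m)^-1 (qfact eta k)^-1 => fm fk.
transitivity (q ((i + k)%:R * (B - m%:R)) * q (- (A * B) / 2) *
   q (weight A (i + k) * weight B m / 2) * q (k%:R * (k%:R - 1) / 2) *
   (dk * fk * P * fmk * fm)); first by ring.
transitivity (q ((- (2 * A) + 2 * (i + k)%:R) * m%:R) * q (- (m%:R * k%:R)) *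
  q (- (k%:R * (A - i%:R) - k%:R * (k%:R - 1) / 2)) *
  q ((m + k)%:R * (A - i%:R)) * (dk * fk * P * fmk * fm)); last by ring.
congr (_ * _); rewrite -!qpowD; congr q.
by rewrite /weight !natrD; field.
Qed.

End Comparison.

Theorem proposition5p2 (R : realType) (eta : R[i]) (Heta : 0 < complex.Im eta)
    (RR : dyn_family R) (HRR : dynamical_R eta RR) :
  forall L1 L2 : R[i],
    quantumR_check eta L1 L2 \o Xi eta L1 L2 =1
    Xi eta L2 L1 \o asymptoticR_check eta RR L1 L2.
Proof.
move=> B A; pose f : {linear _ -> _} := quantumR_check eta B A \o Xi eta B A.
pose g : {linear _ -> _} := Xi eta A B \o asymptoticR_check eta RR B A.
apply: (verma2_ext _ _ _ f g) => m n.
have EXi D1 D2 i j : Xi eta D1 D2 (vb2 D1 D2 i j) =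
    qpow eta (j%:R * (D1 - i%:R)) *: vb2 D1 D2 i j by exact: linext_vb2.
have Eflip : flip B A (vb2 B A m n) = vb2 A B n m by exact: linext_vb2.
have flipZ c t : flip B A (c *: t) = c *: flip B A t by exact: linearZ.
have XiZ c t : Xi eta A B (c *: t) = c *: Xi eta A B t by exact: linearZ.
have quantumRZ c t : quantumR eta A B (c *: t) = c *: quantumR eta A B t.
  exact: linearZ.
transitivity (quantumR eta A B (flip B A (Xi eta B A (vb2 B A m n)))) => //.
transitivity (Xi eta A B (asymptoticR eta RR A B (flip B A (vb2 B A m n)))) => //.
rewrite EXi flipZ quantumRZ !Eflip quantumR_vb // scaler_sumr.
rewrite mxelt_expand => [|i j nE]; last first.
  by rewrite asymptoticR_mxelt // /asymR_coef asym_coef_weight.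
rewrite linear_sum /=.
pose h i : verma2 A B := (asymR_coef eta A n m i (n + m - i) *
  qpow eta ((n + m - i)%:R * (A - i%:R))) *: vb2 A B i (n + m - i).
transitivity (\sum_(i < (n + m).+1) h i); last first.
  apply: eq_bigr => i _; rewrite XiZ EXi scalerA.
  by rewrite asymptoticR_mxelt.
have -> : \sum_(i < (n + m).+1) h i = \sum_(i < n.+1) h i.
  rewrite -!(big_mkord xpredT h) (@big_cat_nat _ _ _ n.+1) //=; last by lia.
  rewrite [X in _ + X]big_nat [X in _ + X]big1 ?addr0 // => i /andP[ni _].
  by rewrite /h /asymR_coef asym_coef_up // mul0r scale0r.
rewrite [RHS](reindex_inj rev_ord_inj) /=; apply: eq_bigr => -[k /= kn] _.
have -> : h (n.+1 - k.+1)%N = (asymR_coef eta A n m (n - k) (m + k) *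
    qpow eta ((m + k)%:R * (A - (n - k)%:R))) *: vb2 A B (n - k) (m + k).
  by rewrite /h (subSS k n) (_ : n + m - (n - k) = m + k)%N //; lia.
etransitivity; first exact: scalerA.
congr (_ *: _); exact: (quantum_asymptotic_coef eta Heta A B n m k kn).
Qed.
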